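(* Let $(G,B,N,S)$ be a Tits system of rank $\ell+1$ with $G$ a finite group, and let $\mathfrak{B}$ be its building, a finite simplicial complex of dimension $\ell$. For every integer $i$ with $0\leq i\leq \ell-1$, the minimal non-zero eigenvalue $m^i(\mathfrak{B})$ of the Laplace operator $\Delta=\delta d$ acting on $C^i(\mathfrak{B})$ satisfies $$m^i(\mathfrak{B})\leq \ell-i.$$
   Context: Tits system (BN-pair) has its usual meaning; its rank is $|S|$. The building $\mathfrak{B}$ of $(G,B,N,S)$ is the simplicial complex whose simplices correspond to the proper parabolic subgroups of $G$ (proper subgroups containing a conjugate of $B$), with the face relation being reverse inclusion; thus vertices correspond to maximal proper parabolic subgroups, and $\ell$-simplices to conjugates of $B$. Every simplex of $\mathfrak{B}$ is a face of an $\ell$-simplex. Let $X$ be a finite simplicial complex of dimension $n$ in which every simplex is a face of some $n$-simplex (for $X=\mathfrak{B}$, $n=\ell$). $\mathrm{Ver}(X)$ is the set of vertices and $S_i(X)$ is the set of oriented $i$-simplices ($i$-simplices with an ordering of the vertices up to even permutation); $\bar s$ is $s$ with the opposite orientation. $C^i(X)$ is the real vector space of functions $f:S_i(X)\to\mathbb{R}$ with $f(\bar s)=-f(s)$ (no condition if $i=0$), and $C^i(X)=0$ for $i<0$ or $i>n$. For a simplex $s$, $w(s)$ is the number of (non-oriented) $n$-simplices of $X$ containing $s$. The coboundary $d:C^i(X)\to C^{i+1}(X)$ is $(df)([v_0,\dots,v_{i+1}])=\sum_{j=0}^{i+1}(-1)^jf([v_0,\dots,\hat v_j,\dots,v_{i+1}])$.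 The map $\delta:C^{i+1}(X)\to C^{i}(X)$ is $(\delta f)(s)=\sum_{v}\frac{w([v,s])}{w(s)}f([v,s])$, the sum being over $v\in\mathrm{Ver}(X)$ such that $\{v\}\cup s$ is an $(i+1)$-simplex, where for $s=[v_0,\dots,v_i]$ one puts $[v,s]=[v,v_0,\dots,v_i]$. The Laplace operator on $C^i(X)$ is $\Delta=\delta d$. It is self-adjoint and positive semi-definite for the inner product $(f,g)=\sum_{s}w(s)f(s)g(s)$ (sum over non-oriented $i$-simplices, each with an arbitrary orientation), so it is diagonalizable with non-negative real eigenvalues. *)

(* Defs.v *)
From HB Require Import structures.
From mathcomp Require Import all_boot all_order all_algebra all_fingroup.
From mathcomp Require Import reals.

Set Implicit Arguments.
Unset Strict Implicit.
Unset Printing Implicit Defensive.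

Import Order.TTheory GRing.Theory Num.Theory.
Local Open Scope ring_scope.

(* A finite simplicial complex with vertices in V is given by the set X of its
   (nonempty) simplices; a simplex is identified with its set of vertices.    *)
Section Complex.
Variables (V : finType) (X : {set {set V}}).

Definition simplices (i : nat) : {set {set V}} := [set s in X | #|s| == i.+1].

Definition dim : nat := (\max_(s in X) #|s|).-1.

Definition weight (s : {set V}) : nat := #|[set c in simplices dim | s \subset c]|.

(* [t] lists the vertices of an i-simplex; the cardinality condition in
   [simplices] forces these i+1 vertices to be distinct.                      *)
Definition ordered_simplex i (t : i.+1.-tuple V) : bool :=
  [set x in t] \in simplices i.

Definition tperms n (t : n.-tuple V) (p : 'S_n) : n.-tuple V :=
  [tuple tnth t (p k) | k < n].

Definition face n (t : n.+1.-tuple V) (j : 'I_n.+1) : n.-tuple V :=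
  [tuple tnth t (lift j k) | k < n].

End Complex.

Section Cochains.
Variables (R : realType) (V : finType) (X : {set {set V}}).

(* An oriented i-simplex is an ordered one up to even permutations, so that a
   function f on oriented i-simplices with f(-s) = - f(s) is the same thing as
   a function on ordered i-simplices that is multiplied by the signature under
   permutations of the vertices (no condition if i = 0). Such a function is
   extended by 0 to all the (i+1)-tuples of vertices.                         *)
Definition cochain_pred (i : nat) : {pred {ffun i.+1.-tuple V -> R^o}} :=
  fun f => [forall t, ~~ ordered_simplex X t ==> (f t == 0)]
        && [forall t, forall p : 'S_i.+1, f (tperms t p) == (-1) ^+ p * f t].

Lemma cochainP i (f : {ffun i.+1.-tuple V -> R^o}) :
  reflect ((forall t, ~~ ordered_simplex X t -> f t = 0) /\
           (forall t (p : 'S_i.+1), f (tperms t p) = (-1) ^+ p * f t))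
          (f \in @cochain_pred i).
Proof.
apply: (iffP andP) => -[f0 fp]; split.
- by move=> t nt; apply/eqP; move/forallP/(_ t)/implyP: f0; apply.
- by move=> t p; apply/eqP; move/forallP/(_ t)/forallP: fp.
- by apply/forallP => t; apply/implyP => /f0 ->.
- by apply/forallP => t; apply/forallP => p; rewrite fp.
Qed.

Lemma cochain_submod_closed i : subsemimod_closed (@cochain_pred i).
Proof.
split; first split.
- by apply/cochainP; split=> [t _|t p]; rewrite !ffunE ?mulr0.
- move=> f g /cochainP[f0 fp] /cochainP[g0 gp]; apply/cochainP.
  split=> [t nt|t p]; rewrite !ffunE; first by rewrite f0 ?g0 ?addr0.
  by rewrite fp gp mulrDr.
- move=> a f /cochainP[f0 fp]; apply/cochainP.
  split=> [t nt|t p]; rewrite !ffunE; first by rewrite f0 ?scaler0.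
  by rewrite fp /GRing.scale /= mulrCA.
Qed.

HB.instance Definition _ i :=
  GRing.isSubmodClosed.Build R {ffun i.+1.-tuple V -> R^o} (@cochain_pred i)
    (@cochain_submod_closed i).

Record cochain (i : nat) : Type := Cochain {
  cochain_val :> {ffun i.+1.-tuple V -> R^o};
  _ : cochain_val \in @cochain_pred i }.

HB.instance Definition _ i := [isSub for @cochain_val i].
HB.instance Definition _ i := [Choice of cochain i by <:].
HB.instance Definition _ i := [SubChoice_isSubLmodule of cochain i by <:].

Lemma set_tperms i (t : i.-tuple V) p : [set x in tperms t p] = [set x in t].
Proof.
apply/setP => x; rewrite !inE; apply/idP/idP => /tnthP[k ->].
  by rewrite tnth_mktuple mem_tnth.
by apply/tnthP; exists ((p^-1)%g k); rewrite tnth_mktuple permKV.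
Qed.

Lemma ordered_simplex_perm i (t : i.+1.-tuple V) p :
  ordered_simplex X (tperms t p) = ordered_simplex X t.
Proof. by rewrite /ordered_simplex set_tperms. Qed.

Definition coboundary_fun i (f : cochain i) : {ffun i.+2.-tuple V -> R^o} :=
  [ffun t => if ordered_simplex X t
             then \sum_(j < i.+2) (-1) ^+ j * f (face t j) else 0].

Lemma lift_perm_ex n (p : 'S_n.+1) j :
  exists q : 'S_n, p = lift_perm j (p j) q.
Proof.
have D k : p j != p (lift j k) by rewrite (inj_eq perm_inj) neq_lift.
pose h k := odflt k (unlift (p j) (p (lift j k))).
have hE k : lift (p j) (h k) = p (lift j k).
  by rewrite /h; have /unlift_some[? ? ->] := D k.
have hI : injective h.
  move=> k k' e; apply: (@lift_inj _ j); apply: (@perm_inj _ p).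
  by rewrite -!hE e.
exists (perm hI); apply/permP => k.
case: (unliftP j k) => [k'|] ->; last by rewrite lift_perm_id.
by rewrite lift_perm_lift permE hE.
Qed.

Lemma coboundary_subproof i (f : cochain i) :
  coboundary_fun f \in @cochain_pred i.+1.
Proof.
have /cochainP[_ fp] := valP f.
apply/cochainP; split=> [t nt|t p]; rewrite !ffunE; first by rewrite (negPf nt).
rewrite ordered_simplex_perm; case: ifP => _; last by rewrite mulr0.
rewrite mulr_sumr [RHS](reindex_inj (@perm_inj _ p)) /=.
apply: eq_bigr => j _; have [q pE] := lift_perm_ex p j.
have -> : face (tperms t p) j = tperms (face t (p j)) q.
  apply: eq_from_tnth => k; rewrite !tnth_mktuple; congr tnth.
  by rewrite {1}pE lift_perm_lift.
rewrite fp mulrA [RHS]mulrA; congr (_ * _).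
rewrite {1}pE odd_lift_perm -(signr_odd _ j) -(signr_odd _ (p j)).
by case: (odd j) (odd (p j)) (odd_perm q) => [] [] [];
  rewrite /= ?(expr0, expr1, mulrNN, mulr1, mul1r).
Qed.

Definition coboundary i (f : cochain i) : cochain i.+1 :=
  Cochain (coboundary_subproof f).

Definition codifferential_fun i (f : cochain i.+1) :
    {ffun i.+1.-tuple V -> R^o} :=
  [ffun s : i.+1.-tuple V => if ordered_simplex X s then
     \sum_(v : V | (v |: [set x in s]) \in simplices X i.+1)
        (weight X (v |: [set x in s]))%:R / (weight X [set x in s])%:R
          * f [tuple of v :: s]
   else 0].

Lemma codifferential_subproof i (f : cochain i.+1) :
  codifferential_fun f \in @cochain_pred i.
Proof.
have /cochainP[_ fp] := valP f.
apply/cochainP; split=> [t nt|t p]; rewrite !ffunE; first by rewrite (negPf nt).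
rewrite ordered_simplex_perm set_tperms; case: ifP => _; last by rewrite mulr0.
rewrite mulr_sumr; apply: eq_bigr => v _.
have -> : [tuple of v :: tperms t p]
        = tperms [tuple of v :: t] (lift_perm ord0 ord0 p).
  apply: eq_from_tnth => k; rewrite tnth_mktuple.
  case: (unliftP ord0 k) => [k'|] ->; last by rewrite lift_perm_id !tnth0.
  by rewrite lift_perm_lift !tnthS tnth_mktuple.
by rewrite fp odd_lift_perm /= mulrCA.
Qed.

Definition codifferential i (f : cochain i.+1) : cochain i :=
  Cochain (codifferential_subproof f).

Definition laplacian i (f : cochain i) : cochain i :=
  codifferential (coboundary f).

End Cochains.

Definition is_eigenvalue (R : realType) (E : lmodType R) (T : E -> E) (a : R) :=
  exists2 f : E, f != 0 & T f = a *: f.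

Definition is_min_nonzero_eigenvalue (R : realType) (E : lmodType R)
    (T : E -> E) (m : R) :=
  [/\ is_eigenvalue T m, m != 0 &
      forall a, is_eigenvalue T a -> a != 0 -> m <= a].

Local Open Scope group_scope.

(* The Weyl group is W = N / (B :&: N); its elements are cosets, i.e. subsets
   of N, so that B * w * B is the double coset BwB. The rank is #|S|.         *)
Record Tits_system (gT : finGroupType) (G B N : {group gT})
    (S : {set coset_of (B :&: N)}) : Prop := {
  Tits_gen : B <*> N = G;
  Tits_normal : B :&: N <| N;
  Tits_Weyl_gen : <<S>> = N / (B :&: N);
  Tits_involution : forall s, s \in S -> #[s] = 2%N;
  Tits_exchange : forall s w, s \in S -> w \in N / (B :&: N) ->
    (s : {set gT}) * B * w \subset
      (B * (w : {set gT}) * B) :|: (B * ((s * w)%g : {set gT}) * B);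
  Tits_thick : forall s, s \in S -> ~~ ((s : {set gT}) * B * s \subset B)
}.

Section Building.
Variables (gT : finGroupType) (G B : {group gT}).

Definition proper_parabolic (P : {group gT}) : bool :=
  (P \proper G) && [exists g in G, B :^ g \subset P].

Definition maximal_parabolic (P : {group gT}) : bool :=
  [max P | proper_parabolic P].

(* The simplex attached to a proper parabolic subgroup P is the set of its
   vertices: as the face relation is reverse inclusion, these are the maximal
   proper parabolic subgroups containing P.                                   *)
Definition parabolic_simplex (P : {group gT}) : {set {group gT}} :=
  [set M : {group gT} | maximal_parabolic M & P \subset M].

Definition building : {set {set {group gT}}} :=
  [set parabolic_simplex P | P : {group gT} & proper_parabolic P].

End Building.

(* Main.v *)
Require Import Defs.
From HB Require Import structures.
From mathcomp Require Import all_boot all_order all_algebra all_fingroup.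
From mathcomp Require Import reals complex polyrcf.

(* A cochain f supported on i-simplices of a single type J satisfies
   (df, df) = (l - i) (f, f): an (i+1)-simplex has at most one face of type J,
   and each chamber containing an i-simplex s contains l - i of the
   (i+1)-simplices that contain s. By the spectral theorem it remains to find
   such an f <> 0 orthogonal to ker d. We take the signed sum over the subgroup
   W_J of the Weyl group of the translates w.c of the face c of type J of the
   fundamental chamber. It is a combinatorial sphere of dimension i; as i < l
   there is a type k not in J, and the sphere is the boundary of the cone with
   apex the vertex of type k of the fundamental chamber, hence it is orthogonal
   to all cocycles. The signs exist because l(s w) and l(w) have different
   parities, which follows from the multiplication rules of the double cosets
   B w B. *)

Set Implicit Arguments.
Unset Strict Implicit.
Unset Printing Implicit Defensive.

Import Order.TTheory GRing.Theory Num.Theory.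
Local Open Scope ring_scope.

(** * Rayleigh quotients of symmetric matrices *)

(** As [A] is symmetric, orthogonality to its kernel puts [v] in its row space, so [v] has no
    component along the eigenvalue 0. In a unitary eigenbasis over [R[i]] the Rayleigh quotient is a
    weighted average of the eigenvalues that [v] involves, and one of these is at most [c]. *)
Lemma symmetric_rayleigh_eigenvalue (R : rcfType) n (A : 'M[R]_n) (v : 'rV_n)
    (c : R) :
    A^T = A -> v != 0 -> (forall u : 'rV_n, u *m A = 0 -> u *m v^T = 0) ->
    (v *m A *m v^T) 0 0 <= c * (v *m v^T) 0 0 ->
  exists a, [/\ a != 0, a <= c & eigenvalue A a].
Proof.
move=> symA v0 kerv ray.
have /submxP[u vE] : (v <= A)%MS.
  rewrite submxE -(inj_eq trmx_inj) trmx0 trmx_mul; apply/eqP/row_matrixP=> k.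
  by rewrite row_mul kerv ?row0 // -row_mul -[X in _ *m X]symA -trmx_mul
    mulmx_coker trmx0 row0.
pose toC : {rmorphism R -> R[i]} := @real_complex_def R (Phant R).
have toC_real x : toC x \is Num.real.
  by rewrite realE -(rmorph0 toC) /toC /= !lecR le_total.
have toC_conj m p (B : 'M[R]_(m, p)) :
    map_mx Num.conj (map_mx toC B) = map_mx toC B.
  by apply/matrixP=> i j; rewrite !mxE; apply/CrealP.
set AC := map_mx toC A.
have nAC : AC \is hermsymmx.
  apply: realsym_hermsym; last by apply/mxOverP=> i j; rewrite mxE.
  by apply/is_hermitianmxP; rewrite expr0 scale1r map_mx_id // map_trmx symA.
have Dreal := hermitian_spectral_diag_real nAC.
have /orthomx_spectralP := hermitian_normalmx nAC.
set P := spectralmx AC in Dreal *; set D := spectral_diag AC in Dreal *.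
have uP : P \is unitarymx := spectral_unitarymx _.
have Pu := unitarymx_unit uP.
move=> ACE.
pose y := map_mx toC v *m invmx P.
(* The coordinate of [v] along an eigenvector carries the eigenvalue as a factor, hence vanishes on
   the kernel. *)
have yE k : y 0 k = (map_mx toC u *m invmx P) 0 k * D 0 k.
  rewrite /y vE map_mxM /= -/AC ACE -!mulmxA mulmxV // mulmx1 mulmxA.
  by rewrite mul_mx_diag [LHS]mxE.
have yyE B : toC ((v *m B *m v^T) 0 0)
    = (y *m (P *m map_mx toC B *m invmx P) *m (map_mx Num.conj y^T)) 0 0.
  have vE' : map_mx toC v = y *m P by rewrite /y mulmxKV.
  transitivity ((map_mx toC v *m map_mx toC B *m map_mx Num.conj (map_mx toC v)^T) 0 0).
    by rewrite map_trmx toC_conj -!map_mxM [RHS]mxE.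
  rewrite {2}vE' trmx_mul map_mxM /= -(invmx_unitary uP) !mulmxA.
  by rewrite -vE'.
have vvE : toC ((v *m v^T) 0 0) = \sum_k `|y 0 k| ^+ 2.
  rewrite -{1}[v]mulmx1 yyE map_mx1 mulmx1 mulmxV // mulmx1 mxE.
  by apply: eq_bigr => k _; rewrite !mxE -normCK.
have vAvE : toC ((v *m A *m v^T) 0 0) = \sum_k D 0 k * `|y 0 k| ^+ 2.
  rewrite yyE -/AC ACE !mulmxA mulmxK // mulmxK // mul_mx_diag mxE.
  by apply: eq_bigr => k _; rewrite !mxE mulrAC -normCK mulrC.
have [/existsP[k /andP[yk Dk]]|] := boolP [exists k, (y 0 k != 0) && (D 0 k <= toC c)].
  have [a aE] : exists a, D 0 k = toC a.
    have /mxOverP/(_ 0 k) := Dreal; rewrite realE; case: (D 0 k) => x z.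
    by rewrite !lecE /= => /orP[]/andP[/eqP z0 _]; exists x; [rewrite z0|rewrite -z0].
  exists a; split.
  - by apply: contraNneq yk => a0; rewrite yE aE a0 rmorph0 mulr0.
  - by move: Dk; rewrite aE lecR.
  - rewrite -(eigenvalue_map toC) -/AC -aE; apply/eigenvalueP.
    exists (row k P).
      rewrite -row_mul {1}ACE !mulmxA mulmxV // mul1mx.
      by apply/rowP=> j; rewrite mul_diag_mx !mxE.
    apply/eqP=> Pk0; have := congr1 (mulmx^~ (invmx P)) Pk0.
    rewrite /= -row_mul mulmxV // mul0mx => /rowP/(_ k).
    by rewrite !mxE eqxx => /eqP; rewrite oner_eq0.
(* If every eigenvalue that [v] involves exceeds [c], the difference of the two quadratic forms is a
   sum of nonnegative terms, not all zero. *)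
rewrite negb_exists => /forallP H; exfalso.
have : 0 < toC ((v *m A *m v^T) 0 0) - toC c * toC ((v *m v^T) 0 0).
  rewrite vAvE vvE mulr_sumr -sumrB.
  under eq_bigr do rewrite -mulrBl.
  have term_ge0 k : 0 <= (D 0 k - toC c) * `|y 0 k| ^+ 2.
    have := H k; rewrite negb_and negbK => /orP[/eqP->|].
      by rewrite normr0 expr0n mulr0.
    have /mxOverP/(_ 0 k) Dk := Dreal.
    by rewrite -real_ltNge // => /ltW; rewrite -subr_ge0 => ?; rewrite mulr_ge0 ?exprn_ge0.
  rewrite lt0r sumr_ge0 // andbT; apply: contraNneq v0 => /eqP.
  rewrite psumr_eq0 // => /allP yk0.
  suff y0 : y = 0 by rewrite -(map_mx_eq0 toC) -[map_mx toC v](mulmxKV Pu) -/y y0 mul0mx.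
  apply/rowP=> k; rewrite [RHS]mxE; have := yk0 k (mem_index_enum k).
  rewrite mulf_eq0 expf_eq0 normr_eq0 /= => /orP[|/eqP //].
  rewrite subr_eq0 => /eqP Dc; have := H k.
  by rewrite negb_and negbK Dc lexx orbF => /eqP.
by rewrite -rmorphM -rmorphB -(rmorph0 toC) ltcR subr_gt0 ltNge ray.
Qed.

Lemma seq_min_exists (d : Order.disp_t) (T : orderType d) (s : seq T) x :
  x \in s -> exists2 m, m \in s & forall y, y \in s -> (m <= y)%O.
Proof.
elim: s x => // z s IHs x _; case: s IHs => [|y s] IHs.
  by exists z; rewrite ?mem_head // => y; rewrite inE => /eqP->.
have [m ms mle] := IHs y (mem_head _ _); exists (Order.min z m).
  by rewrite minEle; case: ifP => _; rewrite inE ?eqxx // ms orbT.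
by move=> t; rewrite inE ge_min => /predU1P[->|/mle ->]; rewrite ?lexx ?orbT.
Qed.

(** Here [phi] embeds [E] in a Euclidean space, and the second condition makes [phi \o psi] the
    orthogonal projection onto its image. The operator [phi \o T \o psi] extends [T] by 0 on the
    orthogonal complement: it is symmetric and has the same nonzero eigenvalues. These are roots of
    a characteristic polynomial, so a least one exists as soon as there is one. *)
Lemma min_nonzero_eigenvalue_le (R : realType) (E : lmodType R)
    (T : {linear E -> E}) n (phi : {linear E -> 'rV[R]_n})
    (psi : {linear 'rV[R]_n -> E}) (f : E) (c : R) :
    cancel phi psi ->
    (forall x v, phi x *m (phi (psi v))^T = phi x *m v^T) ->
    (forall x y, phi (T x) *m (phi y)^T = phi x *m (phi (T y))^T) ->
    f != 0 -> (forall z, T z = 0 -> phi z *m (phi f)^T = 0) ->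
    (phi (T f) *m (phi f)^T) 0 0 <= c * (phi f *m (phi f)^T) 0 0 ->
  exists m, is_min_nonzero_eigenvalue T m /\ m <= c.
Proof.
move=> phiK adj selfadj f0 kerf ray.
pose A := lin1_mx (phi \o T \o psi).
have AE u : u *m A = phi (T (psi u)) by rewrite mul_rV_lin1.
have adj' x v : v *m (phi x)^T = phi (psi v) *m (phi x)^T.
  by apply: trmx_inj; rewrite !trmx_mul !trmxK adj.
have symA : A^T = A.
  have AT (u v : 'rV_n) : u *m A *m v^T = u *m A^T *m v^T.
    by rewrite -[RHS]mulmxA -trmx_mul !AE -adj selfadj -adj'.
  apply/matrixP=> i j; have := AT (delta_mx 0 i) (delta_mx 0 j).
  by rewrite -!rowE trmx_delta -!colE => /matrixP/(_ 0 0); rewrite !mxE.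
have eigE a : a != 0 -> is_eigenvalue T a <-> eigenvalue A a.
  move=> a0; split=> [[e e0 Te]|/eigenvalueP[v vA v0]].
    apply/eigenvalueP; exists (phi e); first by rewrite AE phiK Te linearZ.
    by apply: contraNneq e0 => pe0; rewrite -[e]phiK pe0 linear0.
  rewrite AE in vA; exists (psi v).
    apply: contraNneq v0 => pv0; move/eqP: vA.
    by rewrite pv0 !linear0 eq_sym scaler_eq0 (negPf a0).
  by rewrite -[LHS]phiK vA linearZ.
have [||||a [a0 ac Aa]] := @symmetric_rayleigh_eigenvalue R n A (phi f) c.
- exact: symA.
- by apply: contraNneq f0 => pf0; rewrite -[f]phiK pf0 linear0.
- move=> u; rewrite AE => uA0; rewrite adj' kerf //.
  by rewrite -[LHS]phiK uA0 linear0.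
- by rewrite AE phiK.
have pA0 : char_poly A != 0 by rewrite monic_neq0 // char_poly_monic.
pose eigs := [seq b <- rootsR (char_poly A) | b != 0].
have eigsP b : b != 0 -> is_eigenvalue T b <-> b \in eigs.
  move=> b0; rewrite mem_filter b0 /= -(roots_on_rootsR pA0) in_itv /=.
  by rewrite -eigenvalue_root_char; apply: eigE.
have [m ms mle] := seq_min_exists (proj1 (eigsP a a0) (proj2 (eigE a a0) Aa)).
have m0 : m != 0 by move: ms; rewrite mem_filter => /andP[].
exists m; split; last by apply: le_trans ac; apply/mle/eigsP/eigE.
split=> //; first exact/eigsP.
by move=> b Tb b0; apply/mle/eigsP.
Qed.

(** * Cochains of a pure simplicial complex *)

Section TuplePermutations.
Variables (V : finType).

Lemma tpermsM n (t : n.-tuple V) p q :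
  tperms (tperms t p) q = tperms t (q * p)%g.
Proof. by apply: eq_from_tnth => k; rewrite !tnth_mktuple permM. Qed.

Lemma tperms1 n (t : n.-tuple V) : tperms t 1%g = t.
Proof. by apply: eq_from_tnth => k; rewrite !tnth_mktuple perm1. Qed.

Lemma tperms_bij n (p : 'S_n) : bijective ((@tperms V n)^~ p).
Proof.
by exists ((@tperms V n)^~ p^-1%g) => t; rewrite tpermsM ?mulgV ?mulVg tperms1.
Qed.

Lemma set_tuple_cons n v (t : n.-tuple V) :
  [set x in [tuple of v :: t]] = v |: [set x in t].
Proof. by apply/setP=> x; rewrite !inE. Qed.

(** The cycle that brings entry [j] to the front and keeps the order of the others. Its sign is that
    of the [j]-th face in the coboundary, so every face can be treated as the face opposite to the
    first vertex. *)
Definition to_front n (j : 'I_n.+1) : 'S_n.+1 := lift_perm ord0 j 1%g.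

Lemma odd_to_front n (j : 'I_n.+1) : odd_perm (to_front j) = odd j.
Proof. by rewrite odd_lift_perm /= odd_perm1 addbF. Qed.

Lemma tperms_to_front n (t : n.+1.-tuple V) j :
  tperms t (to_front j) = [tuple of tnth t j :: face t j].
Proof.
apply: eq_from_tnth => k; rewrite tnth_mktuple.
case: (unliftP ord0 k) => [k'|] ->; last by rewrite lift_perm_id !tnth0.
by rewrite lift_perm_lift perm1 !tnthS tnth_mktuple.
Qed.

Lemma face_cons n v (t : n.-tuple V) : face [tuple of v :: t] ord0 = t.
Proof. by apply: eq_from_tnth => k; rewrite tnth_mktuple tnthS. Qed.

Lemma sum_tuple_cons (M : nmodType) n (F : n.+1.-tuple V -> M) :
  \sum_t F t = \sum_(s : n.-tuple V) \sum_v F [tuple of v :: s].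
Proof.
rewrite exchange_big pair_big /=.
rewrite (reindex (fun p : V * n.-tuple V => [tuple of p.1 :: p.2])) //=.
exists (fun t => (thead t, [tuple of behead t])) => [[v s] _|t _] /=.
  by rewrite theadE; congr pair; apply: val_inj.
by rewrite -tuple_eta.
Qed.

Lemma sum_to_front (R : pzSemiRingType) n (F : n.+1.-tuple V -> R) :
  \sum_t \sum_j F (tperms t (to_front j))
  = n.+1%:R * \sum_(s : n.-tuple V) \sum_v F [tuple of v :: s].
Proof.
rewrite exchange_big -sum_tuple_cons /= mulr_natl -[X in _ *+ X]card_ord.
rewrite -sumr_const; apply: eq_bigr => j _; symmetry.
by rewrite (reindex_inj (bij_inj (tperms_bij (to_front j)))).
Qed.

End TuplePermutations.

Section Weights.
Variables (V : finType) (X : {set {set V}}) (l : nat).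
Hypotheses (subX : forall s t : {set V},
    t \in X -> s \subset t -> s != set0 -> s \in X)
  (chamberX : forall s, s \in X ->
    exists2 c, c \in simplices X l & s \subset c)
  (dimX : Defs.dim X = l).

Lemma weight_gt0 s : s \in X -> (0 < weight X s)%N.
Proof.
move=> /chamberX[c cX sc]; rewrite /weight dimX card_gt0.
by apply/set0Pn; exists c; rewrite inE cX.
Qed.

(** Double count of the pairs of a chamber [c] containing [s] and a vertex [v] of [c] outside [s]:
    each chamber has [l - i] such vertices. *)
Lemma sum_weight_cone i s : s \in simplices X i ->
  (\sum_(v | v |: s \in simplices X i.+1) weight X (v |: s)
   = (l - i) * weight X s)%N.
Proof.
rewrite inE => /andP[sX /eqP sc].
rewrite /weight dimX; under eq_bigr do rewrite -sum1_card.
rewrite (exchange_big_dep (mem [set c in simplices X l | s \subset c])) /=.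
  rewrite mulnC -sum_nat_const; apply: eq_bigr => c; rewrite !inE.
  move=> /andP[/andP[cX /eqP cc] sc'].
  have -> : (l - i = #|c :\: s|)%N.
    by rewrite cardsD (setIidPr sc') cc sc subSS.
  rewrite -sum1_card; apply: eq_bigl => v; rewrite !inE.
  rewrite cX cc eqxx /= subUset sub1set sc' andbT cardsU1 sc.
  case: (v \in s) => //=; first by rewrite add0n eqSS ltn_eqF // andbF.
  rewrite add1n eqxx andbT; case vc: (v \in c); rewrite ?andbF // andbT.
  apply: subX cX _ _; first by rewrite subUset sub1set vc.
  by apply/set0Pn; exists v; rewrite setU11.
by move=> v c _; rewrite !inE subUset => /and3P[-> _ ->].
Qed.

End Weights.

(** * The weighted inner product and the adjointness of [coboundary] and [codifferential] *)

Section CochainProduct.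
Variables (R : realType) (V : finType) (X : {set {set V}}).

Lemma cochain_out i (f : cochain R X i) t : ~~ ordered_simplex X t -> f t = 0.
Proof. by have /cochainP[f0 _] := valP f; apply: f0. Qed.

Lemma cochain_tperms i (f : cochain R X i) t (p : 'S_i.+1) :
  f (tperms t p) = (-1) ^+ p * f t.
Proof. by have /cochainP[_ fp] := valP f; apply: fp. Qed.

Lemma cochain_to_front i (f : cochain R X i) t j :
  f (tperms t (to_front j)) = (-1) ^+ j * f t.
Proof. by rewrite cochain_tperms odd_to_front signr_odd. Qed.

Lemma coboundary_is_linear i : linear (@coboundary R V X i).
Proof.
move=> a f g; apply/val_inj/ffunP=> t; rewrite !ffunE.
case: ifP => _; last by rewrite scaler0 addr0.
rewrite scaler_sumr -big_split /=; apply: eq_bigr => j _.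
by rewrite !ffunE mulrDr /GRing.scale /= mulrCA.
Qed.

Lemma codifferential_is_linear i : linear (@codifferential R V X i).
Proof.
move=> a f g; apply/val_inj/ffunP=> t; rewrite !ffunE.
case: ifP => _; last by rewrite scaler0 addr0.
rewrite scaler_sumr -big_split /=; apply: eq_bigr => j _.
by rewrite !ffunE mulrDr /GRing.scale /= mulrCA.
Qed.

Lemma laplacian_is_linear i : linear (@laplacian R V X i).
Proof.
by move=> a f g; rewrite /laplacian coboundary_is_linear codifferential_is_linear.
Qed.

HB.instance Definition _ i :=
  GRing.isLinear.Build R _ _ _ (@laplacian R V X i) (@laplacian_is_linear i).

(** The sum runs over ordered simplices, so this is [(i+1)!] times the inner product over
    non-oriented ones; hence the factors [i.+2%:R] when degrees [i] and [i.+1] are compared. *)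
Definition cochain_dot i (f g : cochain R X i) : R :=
  \sum_(t : i.+1.-tuple V) (weight X [set x in t])%:R * (f t * g t).

Lemma cochain_dotC i (f g : cochain R X i) : cochain_dot f g = cochain_dot g f.
Proof. by apply: eq_bigr => t _; rewrite (mulrC (f t)). Qed.

Hypothesis weight_X : forall s, s \in X -> (0 < weight X s)%N.

Lemma weight_neq0 i (t : i.+1.-tuple V) :
  ordered_simplex X t -> (weight X [set x in t])%:R != 0 :> R.
Proof.
by move=> /setIdP[tX _]; rewrite pnatr_eq0 -lt0n weight_X.
Qed.

Lemma cochain_dot_eq0 i (f : cochain R X i) : cochain_dot f f = 0 -> f = 0.
Proof.
move/eqP; rewrite psumr_eq0 => [/allP f0|t _]; last first.
  by rewrite mulr_ge0 // -expr2 sqr_ge0.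
apply/val_inj/ffunP=> t; rewrite ffunE.
have [tX|/(cochain_out f)//] := boolP (ordered_simplex X t).
have := f0 t (mem_index_enum t).
by rewrite /= mulf_eq0 (negPf (weight_neq0 tX)) mulf_eq0 orbb => /eqP.
Qed.

(** Moving a vertex to the front turns the sum over faces into a sum over cones [v :: s]; the
    quotient of weights in [codifferential] then trades the weight of [s] for that of the cone. *)
Lemma coboundary_adjoint i (f : cochain R X i) (g : cochain R X i.+1) :
  cochain_dot (coboundary f) g = i.+2%:R * cochain_dot f (codifferential g).
Proof.
pose F (t : i.+2.-tuple V) : R :=
  (weight X [set x in t])%:R * (f (face t ord0) * g t).
transitivity (\sum_t \sum_j F (tperms t (to_front j))).
  apply: eq_bigr => t _.
  under eq_bigr do rewrite /F set_tperms cochain_to_front mulrCA.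
  under eq_bigr do rewrite [X in face X]tperms_to_front face_cons mulrCA.
  rewrite ffunE.
  have [_|/(cochain_out g)->] := boolP (ordered_simplex X t); last first.
    by rewrite !mulr0 big1 // => j _; rewrite !mulr0.
  rewrite mulr_suml mulr_sumr; apply: eq_bigr => j _.
  by rewrite -[in LHS]mulrA [in LHS](mulrCA ((-1) ^+ j)).
rewrite sum_to_front; congr (_ * _); apply: eq_bigr => s _.
under eq_bigr do rewrite /F face_cons set_tuple_cons.
have [sX|/(cochain_out f)->] := boolP (ordered_simplex X s); last first.
  by rewrite mul0r mulr0 big1 // => v _; rewrite mul0r mulr0.
rewrite ffunE sX !mulr_sumr [RHS]big_mkcond /=; apply: eq_bigr => v _.
case: ifPn => [_|vs].
  rewrite -(mulrA _ _ (g _)) [RHS]mulrCA [X in _ = _ * X]mulrCA.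
  by rewrite mulVKf ?weight_neq0 // mulrCA.
by rewrite [g _]cochain_out ?mulr0 // /ordered_simplex set_tuple_cons.
Qed.

End CochainProduct.

(** * The eigenvalue bound from a sparse cochain orthogonal to the cocycles *)

Section SparseCochains.
Variables (R : realType) (V : finType) (X : {set {set V}}) (l : nat).
Hypotheses (subX : forall s t : {set V},
    t \in X -> s \subset t -> s != set0 -> s \in X)
  (chamberX : forall s, s \in X ->
    exists2 c, c \in simplices X l & s \subset c)
  (dimX : Defs.dim X = l).

Let weight_X := weight_gt0 chamberX dimX.

Definition sparse i (f : cochain R X i) :=
  forall (t : i.+2.-tuple V) j k, ordered_simplex X t ->
  f (face t j) != 0 -> f (face t k) != 0 -> j = k.

Lemma sparse_rayleigh i (f : cochain R X i) : sparse f ->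
  cochain_dot (coboundary f) (coboundary f)
  = i.+2%:R * ((l - i)%:R * cochain_dot f f).
Proof.
move=> sf; pose F (t : i.+2.-tuple V) : R :=
  (ordered_simplex X t)%:R *
    ((weight X [set x in t])%:R * (f (face t ord0) * f (face t ord0))).
transitivity (\sum_t \sum_j F (tperms t (to_front j))).
  apply: eq_bigr => t _; rewrite /F.
  under eq_bigr do rewrite ordered_simplex_perm set_tperms tperms_to_front face_cons.
  rewrite ffunE; have [tX|_] := boolP (ordered_simplex X t); last first.
    by rewrite !mulr0 big1 // => j _; rewrite mul0r.
  under [RHS]eq_bigr do rewrite mul1r.
  rewrite -mulr_sumr; congr (_ * _); rewrite mulr_suml; apply: eq_bigr => j _.
  (* The cross terms of the squared coboundary vanish: at most one face of [t] lies in the support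
     of [f]. *)
  have [->|fj] := eqVneq (f (face t j)) 0; first by rewrite !mulr0 mul0r.
  rewrite (bigD1 j) //= big1 ?addr0 => [|k kj].
    by rewrite mulrACA -signr_odd -expr2 sqrr_sign mul1r.
  have [->|fk] := eqVneq (f (face t k)) 0; first by rewrite mulr0.
  by rewrite (sf t k j) ?eqxx in kj.
rewrite sum_to_front; congr (_ * _); rewrite mulr_sumr; apply: eq_bigr => s _.
under eq_bigr do rewrite /F face_cons /ordered_simplex set_tuple_cons mulrA.
rewrite -mulr_suml [RHS]mulrA; have [sX|/(cochain_out f)->] := boolP (ordered_simplex X s);
  last by rewrite mul0r !mulr0.
congr (_ * _); rewrite -natrM -(sum_weight_cone subX dimX sX) natr_sum [RHS]big_mkcond.
by apply: eq_bigr => v _; case: ifP => _; rewrite ?mul0r ?mul1r.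
Qed.

(** With the factor [1/(i+1)!] this is a projection of the functions on tuples onto the cochains. *)
Definition antisymmetrize_fun i (h : i.+1.-tuple V -> R) :
    {ffun i.+1.-tuple V -> R^o} :=
  [ffun t => if ordered_simplex X t
    then (i.+1)`!%:R^-1 * \sum_(p : 'S_i.+1) (-1) ^+ p * h (tperms t p) else 0].

Lemma antisymmetrize_subproof i (h : i.+1.-tuple V -> R) :
  antisymmetrize_fun h \in @cochain_pred R V X i.
Proof.
apply/cochainP; split=> [t nt|t p]; rewrite !ffunE; first by rewrite (negPf nt).
rewrite ordered_simplex_perm; case: ifP => _; last by rewrite mulr0.
rewrite mulrCA; congr (_ * _); rewrite mulr_sumr.
rewrite (reindex_inj (mulIg p^-1)%g) /=; apply: eq_bigr => q _.
by rewrite tpermsM mulgKV odd_permM odd_permV mulrA -signr_addb addbC.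
Qed.

Definition antisymmetrize i h : cochain R X i :=
  Cochain (@antisymmetrize_subproof i h).

Lemma antisymmetrize_id i (f : cochain R X i) : antisymmetrize f = f.
Proof.
apply/val_inj/ffunP=> t; rewrite ffunE.
have [tX|/(cochain_out f)//] := boolP (ordered_simplex X t).
under eq_bigr do rewrite cochain_tperms mulrA -expr2 sqrr_sign mul1r.
rewrite sumr_const card_Sn -(mulr_natl (f t : R)) mulKf //.
by rewrite pnatr_eq0 -lt0n fact_gt0.
Qed.

(** The cochain [f] absorbs the signs, so all orderings of a simplex contribute equally, and [h]
    itself may be used to compute the product. *)
Lemma antisymmetrize_adjoint i (f : cochain R X i) h :
  cochain_dot f (antisymmetrize h)
  = \sum_(t : i.+1.-tuple V) (weight X [set x in t])%:R * (f t * h t).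
Proof.
pose F (t : i.+1.-tuple V) := (weight X [set x in t])%:R * (f t * h t).
have fact0 : (i.+1)`!%:R != 0 :> R by rewrite pnatr_eq0 -lt0n fact_gt0.
apply: (mulfI fact0).
transitivity (\sum_t \sum_(p : 'S_i.+1) F (tperms t p)).
  rewrite mulr_sumr; apply: eq_bigr => t _; rewrite ffunE /F.
  under [RHS]eq_bigr do rewrite set_tperms cochain_tperms (mulrC _ (f t)) -(mulrA (f t)).
  rewrite -!mulr_sumr mulrCA; congr (_ * _).
  have [tX|/(cochain_out f)->] := boolP (ordered_simplex X t); last first.
    by rewrite !mul0r mulr0.
  rewrite mulrCA mulVKf //.
rewrite exchange_big /= mulr_natl -card_Sn -sumr_const.
by apply: eq_bigr => p _; rewrite [RHS](reindex_inj (bij_inj (tperms_bij V p))).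
Qed.

(* The square root of the weight, made nonzero off the simplices. *)
Let rootw i (t : i.+1.-tuple V) : R :=
  if ordered_simplex X t then Num.sqrt (weight X [set x in t])%:R else 1.

Let rootw_neq0 i (t : i.+1.-tuple V) : rootw t != 0.
Proof.
rewrite /rootw; case: ifP => [/setIdP[tX _]|_]; last exact: oner_neq0.
by rewrite gt_eqF // sqrtr_gt0 ltr0n weight_X.
Qed.

Let rootwM i (f : cochain R X i) t (a : R) :
  rootw t * f t * (rootw t * a) = (weight X [set x in t])%:R * (f t * a).
Proof.
have [tX|/(cochain_out f)->] := boolP (ordered_simplex X t); last first.
  by rewrite mulr0 !mul0r mulr0.
by rewrite mulrACA /rootw tX -expr2 sqr_sqrtr.
Qed.

(** The factor [rootw] turns the weighted product of cochains into the standard product of rows;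
    [row_cochain] is its adjoint and left inverse. *)
Definition cochain_row i (f : cochain R X i) : 'rV[R]_#|{: i.+1.-tuple V}| :=
  \row_k (rootw (enum_val k) * f (enum_val k)).

Definition row_cochain i (v : 'rV[R]_#|{: i.+1.-tuple V}|) : cochain R X i :=
  antisymmetrize (fun t => v 0 (enum_rank t) / rootw t).

Lemma cochain_row_is_linear i : linear (@cochain_row i).
Proof. by move=> a f g; apply/rowP=> k; rewrite !mxE !ffunE mulrDr mulrCA. Qed.

Lemma row_cochain_is_linear i : linear (@row_cochain i).
Proof.
move=> a u v; apply/val_inj/ffunP=> t; rewrite !ffunE.
case: ifP => _; last by rewrite scaler0 addr0.
rewrite /GRing.scale /= mulrCA -mulrDr; congr (_ * _).
rewrite mulr_sumr -big_split; apply: eq_bigr => p _ /=.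
by rewrite !mxE mulrDl mulrDr -!mulrA mulrCA.
Qed.

HB.instance Definition _ i :=
  GRing.isLinear.Build R _ _ _ (@cochain_row i) (@cochain_row_is_linear i).

HB.instance Definition _ i :=
  GRing.isLinear.Build R _ _ _ (@row_cochain i) (@row_cochain_is_linear i).

Lemma cochain_rowK i : cancel (@cochain_row i) (@row_cochain i).
Proof.
move=> f; rewrite -[RHS]antisymmetrize_id; apply/val_inj/ffunP=> t.
rewrite !ffunE; case: ifP => // _; congr (_ * _); apply: eq_bigr => p _.
by rewrite mxE enum_rankK (mulrC (rootw _)) mulfK.
Qed.

Lemma mul_cochain_row i (f : cochain R X i) (v : 'rV_#|{: i.+1.-tuple V}|) :
  cochain_row f *m v^T
  = (\sum_(t : i.+1.-tuple V)
       (weight X [set x in t])%:R * (f t * (v 0 (enum_rank t) / rootw t)))%:M.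
Proof.
rewrite [LHS]mx11_scalar mxE; congr (_%:M).
rewrite (reindex _ (onW_bij _ (@enum_rank_bij (i.+1.-tuple V)))).
apply: eq_bigr => t _; rewrite !mxE enum_rankK -rootwM; congr (_ * _).
by rewrite mulrC divfK.
Qed.

Lemma cochain_row_dot i (f g : cochain R X i) :
  cochain_row f *m (cochain_row g)^T = (cochain_dot f g)%:M.
Proof.
rewrite mul_cochain_row; congr (_%:M); apply: eq_bigr => t _.
by rewrite mxE enum_rankK mulrC (mulrC (rootw t)) mulfK // mulrC.
Qed.

Lemma sparse_min_nonzero_eigenvalue_le i (f : cochain R X i) :
    f != 0 -> sparse f ->
    (forall z : cochain R X i, coboundary z = 0 -> cochain_dot z f = 0) ->
  exists m, is_min_nonzero_eigenvalue (@laplacian R V X i) m /\ m <= (l - i)%:R.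
Proof.
move=> f0 sf zf.
have lapE (g h : cochain R X i) : i.+2%:R * cochain_dot g (laplacian h)
    = cochain_dot (coboundary g) (coboundary h).
  by rewrite coboundary_adjoint.
have i2 : i.+2%:R != 0 :> R by rewrite pnatr_eq0.
apply: (@min_nonzero_eigenvalue_le R _ (@laplacian R V X i) _
  (@cochain_row i) (@row_cochain i) f) => //.
- exact: cochain_rowK.
- by move=> g v; rewrite cochain_row_dot antisymmetrize_adjoint mul_cochain_row.
- move=> g h; rewrite !cochain_row_dot cochain_dotC; congr (_%:M).
  by apply: (mulfI i2); rewrite !lapE cochain_dotC.
(* A cochain killed by the Laplacian is a cocycle, since its product with its Laplacian is a
   multiple of the square norm of its coboundary. *)
- move=> z z0; rewrite cochain_row_dot zf ?raddf0 //.
  by apply: (cochain_dot_eq0 weight_X); rewrite -lapE z0 cochain_dotC /cochain_dot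
    big1 ?mulr0 // => t _; rewrite ffunE mul0r mulr0.
- rewrite !cochain_row_dot !mxE !mulr1n cochain_dotC.
  have /(mulfI i2)-> // : i.+2%:R * cochain_dot f (laplacian f)
    = i.+2%:R * ((l - i)%:R * cochain_dot f f).
  by rewrite lapE sparse_rayleigh.
Qed.

End SparseCochains.

(** * Tits systems *)

Section TitsSystems.
Local Open Scope group_scope.

Lemma gen_ind (gT : finGroupType) (A : {set gT}) (K : gT -> Prop) :
    K 1 -> (forall s v, s \in A -> v \in <<A>> -> K v -> K (s * v)) ->
  forall w, w \in <<A>> -> K w.
Proof.
move=> K1 KM w /gen_prodgP[n [c cA ->]].
elim: n c cA => [|n IHn] c cA; first by rewrite big_ord0.
rewrite big_ord_recl; apply: KM => //; last by apply: IHn => k; apply: cA.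
by apply: group_prod => k _; apply/mem_gen/cA.
Qed.

(** * Word length with respect to a generating set *)

Section WordLength.
Variables (gT : finGroupType) (S : {set gT}).

Lemma word_length_ex w : exists q, (w \in <<S>>) ==> (w \in (1 |: S) ^+ q).
Proof.
case: (boolP (w \in <<S>>)) => [wS|_]; last by exists 0%N.
move: w wS; apply: gen_ind => [|s v sS _ [q vq]].
  by exists 0%N; rewrite expg0 set11.
by exists q.+1; rewrite expgS mem_mulg //= !inE sS orbT.
Qed.

(** The power [(1 |: S) ^+ q] consists of the products of at most [q] elements of [S]. Outside
    [<<S>>] the implication is vacuous and the length is 0. *)
Definition word_length w := ex_minn (word_length_ex w).

Lemma word_length_le w q : w \in <<S>> ->
  (word_length w <= q)%N = (w \in (1 |: S) ^+ q).
Proof.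
rewrite /word_length => wS; case: ex_minnP => m; rewrite wS /= => wm min_m.
apply/idP/idP => [/subnKC<-|]; last exact: min_m.
rewrite expgD; elim: (q - m)%N => [|k IHk]; first by rewrite expg0 mulg1.
by rewrite expgSr mulgA -[w]mulg1 mem_mulg // !inE eqxx.
Qed.

Lemma word_length1 : word_length 1 = 0%N.
Proof. by apply/eqP; rewrite -leqn0 word_length_le ?group1 // expg0 set11. Qed.

Lemma word_length_eq0 w : w \in <<S>> -> word_length w = 0%N -> w = 1.
Proof.
move=> wS /eqP; rewrite -leqn0 word_length_le // expg0.
by move/set1P.
Qed.

Lemma word_lengthMl s w : s \in S -> w \in <<S>> ->
  (word_length (s * w)%g <= (word_length w).+1)%N.
Proof.
move=> sS wS; rewrite word_length_le ?groupM ?(mem_gen sS) // expgS.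
by rewrite mem_mulg -?word_length_le // !inE sS orbT.
Qed.

Lemma word_lengthMr s w : s \in S -> w \in <<S>> ->
  (word_length (w * s)%g <= (word_length w).+1)%N.
Proof.
move=> sS wS; rewrite word_length_le ?groupM ?(mem_gen sS) // expgSr.
by rewrite mem_mulg -?word_length_le // !inE sS orbT.
Qed.

Lemma word_length_Sl w q : w \in <<S>> -> word_length w = q.+1 ->
  exists s v, [/\ s \in S, v \in <<S>>, w = s * v & word_length v = q].
Proof.
move=> wS wq; have : w \in (1 |: S) ^+ q.+1 by rewrite -word_length_le ?wq.
rewrite expgS => /mulsgP[s v /setU1P s1S vq wE].
have sS : s \in <<S>> by case: s1S => [->|/mem_gen].
have vS : v \in <<S>> by rewrite -(groupMl _ sS) -wE.
have vq' : (word_length v <= q)%N by rewrite word_length_le.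
case: s1S => [s1|{}sS]; first by rewrite s1 mul1g in wE; rewrite -wE wq ltnn in vq'.
exists s, v; split=> //; apply/eqP; rewrite eqn_leq vq' -ltnS -wq wE.
exact: word_lengthMl.
Qed.

Lemma word_length_Sr w q : w \in <<S>> -> word_length w = q.+1 ->
  exists v s, [/\ s \in S, v \in <<S>>, w = v * s & word_length v = q].
Proof.
move=> wS wq; have : w \in (1 |: S) ^+ q.+1 by rewrite -word_length_le ?wq.
rewrite expgSr => /mulsgP[v s vq /setU1P s1S wE].
have sS : s \in <<S>> by case: s1S => [->|/mem_gen].
have vS : v \in <<S>> by rewrite -(groupMr _ sS) -wE.
have vq' : (word_length v <= q)%N by rewrite word_length_le.
case: s1S => [s1|{}sS]; first by rewrite s1 mulg1 in wE; rewrite -wE wq ltnn in vq'.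
exists v, s; split=> //; apply/eqP; rewrite eqn_leq vq' -ltnS -wq wE.
exact: word_lengthMr.
Qed.

End WordLength.

(** The axioms are relative to [<<S>>] and do not mention [G], so that they pass to every subset [I]
    of [S]. The results on double cosets then hold also for [<<I>>] with its own length function. *)
Record BN_axioms (gT : finGroupType) (B N : {group gT})
    (S : {set coset_of (B :&: N)}) : Prop := {
  BN_normal : B :&: N <| N;
  BN_sub : S \subset N / (B :&: N);
  BN_involution : forall s, s \in S -> #[s] = 2%N;
  BN_exchange : forall s w, s \in S -> w \in <<S>> ->
    (s : {set gT}) * B * w \subset
      (B * (w : {set gT}) * B) :|: (B * ((s * w)%g : {set gT}) * B);
  BN_thick : forall s, s \in S -> ~~ ((s : {set gT}) * B * s \subset B)
}.

Lemma BN_axioms_sub (gT : finGroupType) (B N : {group gT})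
    (S I : {set coset_of (B :&: N)}) :
  I \subset S -> BN_axioms S -> BN_axioms I.
Proof.
move=> sIS [nHN SN invS exchS thickS]; split=> //.
- exact: subset_trans SN.
- by move=> s /(subsetP sIS); apply: invS.
- by move=> s w /(subsetP sIS) sS wI; apply: exchS => //; apply: subsetP wI; apply: genS.
- by move=> s /(subsetP sIS); apply: thickS.
Qed.

Lemma Tits_system_BN (gT : finGroupType) (G B N : {group gT})
    (S : {set coset_of (B :&: N)}) :
  Tits_system G S -> BN_axioms S.
Proof.
case=> _ nHN genS invS exchS thickS; split=> //.
- by rewrite -genS subset_gen.
- by move=> s w sS; rewrite genS; apply: exchS.
Qed.

(** * Multiplication of double cosets and the length function *)

Section DoubleCosets.
Variables (gT : finGroupType) (B N : {group gT}).
Variable (S : {set coset_of (B :&: N)}).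
Hypothesis BN : BN_axioms S.

Local Notation H := (B :&: N).
Local Notation W := <<S>>.
Implicit Types (s v w : coset_of H) (g h x y : gT).

Definition cell w : {set gT} := B * w * B.

Lemma memWN w : w \in W -> w \in N / H.
Proof. by apply/subsetP; rewrite gen_subG (BN_sub BN). Qed.

Lemma coset_sub w x : w \in N / H -> x \in w -> x \in N.
Proof.
move=> /morphimP[n nN nN' ->]; rewrite /= val_coset // => /rcosetP[h hH ->].
by rewrite groupM //; case/setIP: hH.
Qed.

Lemma N_norm x : x \in N -> x \in 'N(H).
Proof. by apply/subsetP/normal_norm/(BN_normal BN). Qed.

Lemma mem_coset x : x \in N -> x \in coset H x.
Proof. by move=> xN; rewrite val_coset ?N_norm // rcoset_refl. Qed.

Lemma mem_coset1 x : (x \in (1 : coset_of H)) = (x \in H).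
Proof. by rewrite -(morph1 (coset_morphism H)) coset1. Qed.

Lemma mem_cosetM v w x y : v \in N / H -> w \in N / H ->
  x \in v -> y \in w -> x * y \in v * w.
Proof.
move=> vN wN xv yw; have xN := coset_sub vN xv; have yN := coset_sub wN yw.
by rewrite -(coset_mem xv) -(coset_mem yw) -morphM ?N_norm // mem_coset ?groupM.
Qed.

Lemma mem_cosetV v x : v \in N / H -> x \in v -> x^-1 \in v^-1.
Proof.
move=> vN xv; have xN := coset_sub vN xv.
by rewrite -(coset_mem xv) -morphV ?N_norm // mem_coset ?groupV.
Qed.

Lemma mem_cell w g : reflect
  (exists b x b', [/\ b \in B, x \in w, b' \in B & g = b * x * b']) (g \in cell w).
Proof.
apply: (iffP mulsgP) => [[bx b' /mulsgP[b x bB xw ->] b'B ->]|].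
  by exists b, x, b'.
move=> [b [x [b' [bB xw b'B ->]]]].
by exists (b * x) b' => //; apply: mem_mulg.
Qed.

Lemma coset_cell w x : x \in w -> x \in cell w.
Proof. by move=> xw; apply/mem_cell; exists 1, x, 1; rewrite !group1 mul1g mulg1. Qed.

Lemma cellMl w b g : b \in B -> (b * g \in cell w) = (g \in cell w).
Proof.
have cl b' g' : b' \in B -> g' \in cell w -> b' * g' \in cell w.
  move=> b'B /mem_cell[c [x [c' [cB xw c'B ->]]]]; apply/mem_cell.
  by exists (b' * c), x, c'; rewrite groupM // !mulgA.
move=> bB; apply/idP/idP; last exact: cl.
by move=> /(cl _ _ (groupVr bB)); rewrite mulKg.
Qed.

Lemma cellMr w b g : b \in B -> (g * b \in cell w) = (g \in cell w).
Proof.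
have cl b' g' : b' \in B -> g' \in cell w -> g' * b' \in cell w.
  move=> b'B /mem_cell[c [x [c' [cB xw c'B ->]]]]; apply/mem_cell.
  by exists c, x, (c' * b'); rewrite groupM // !mulgA.
move=> bB; apply/idP/idP; last exact: cl.
by move=> /(cl _ _ (groupVr bB)); rewrite mulgK.
Qed.

Lemma cell1 : cell 1 = B.
Proof.
apply/setP=> g; apply/mem_cell/idP => [[b [x [b' [bB xH b'B ->]]]]|gB].
  rewrite !groupM //; move: xH; rewrite /= mem_coset1.
  by case/setIP.
exists g, 1, 1; rewrite gB !group1 !mulg1; split=> //.
Qed.

Lemma cellV w g : w \in N / H -> (g^-1 \in cell w^-1) = (g \in cell w).
Proof.
have cl v h : v \in N / H -> h \in cell v -> h^-1 \in cell v^-1.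
  move=> vN /mem_cell[b [x [b' [bB xv b'B ->]]]]; apply/mem_cell.
  by exists b'^-1, x^-1, b^-1; rewrite !groupV !invMg mulgA mem_cosetV.
move=> wN; apply/idP/idP; last exact: cl.
by move/cl; rewrite !invgK groupV; apply.
Qed.

Lemma coset_divB v x y : v \in N / H -> x \in v -> y \in v -> y * x^-1 \in B.
Proof.
move=> vN xv yv; have /coset_mem yx : y * x^-1 \in (1 : coset_of H).
  rewrite -(mulgV v); apply: mem_cosetM; rewrite ?groupV //.
  exact: mem_cosetV.
have yxN : y * x^-1 \in N by rewrite groupM ?groupV ?(coset_sub vN).
by have /setIP[] := coset_idr (N_norm yxN) yx.
Qed.

Lemma cell_sub v w g : w \in N / H -> v \in N / H ->
  g \in cell v -> g \in cell w -> v \subset cell w.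
Proof.
move=> wN vN /mem_cell[b [x [b' [bB xv b'B ->]]]].
rewrite cellMr // cellMl // => xw; apply/subsetP=> y yv.
by rewrite -[y](mulgKV x) cellMl ?(coset_divB vN).
Qed.

Lemma cell_cell_sub v w g : w \in W -> v \in W ->
  g \in cell v -> g \in cell w -> cell v = cell w.
Proof.
move=> /memWN wN /memWN vN gv gw.
have subc (u u' : coset_of H) : u \subset cell u' -> cell u \subset cell u'.
  move=> /subsetP uu'; apply/subsetP=> h /mem_cell[b [x [b' [bB /uu' xu b'B ->]]]].
  by rewrite cellMr // cellMl.
apply/eqP; rewrite eqEsubset.
by apply/andP; split; apply: subc; [apply: cell_sub gv gw|apply: cell_sub gw gv].
Qed.

Lemma cell_mul_simple s w g h : s \in S -> w \in W ->
  g \in cell s -> h \in cell w -> (g * h \in cell w) || (g * h \in cell (s * w)).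
Proof.
move=> sS wW /mem_cell[b [x [b' [bB xs b'B ->]]]] /mem_cell[c [y [c' [cB yw c'B ->]]]].
have -> : b * x * b' * (c * y * c') = b * (x * (b' * c) * y) * c' by rewrite !mulgA.
rewrite !(cellMr _ _ c'B) !(cellMl _ _ bB); apply/orP/setUP.
apply: (subsetP (BN_exchange BN sS wW)).
by rewrite !mem_mulg ?groupM.
Qed.

Lemma involution_inv s : s \in S -> s^-1 = s.
Proof.
by move=> sS; apply/eqP; rewrite eq_invg_mul -[s * s]/(s ^+ 2) -(BN_involution BN sS) expg_order.
Qed.

Lemma simple_neq1 s : s \in S -> s != 1.
Proof. by move=> sS; rewrite -order_eq1 (BN_involution BN sS). Qed.

Lemma simpleK s w : s \in S -> s * (s * w) = w.
Proof. by move=> sS; rewrite -{1}(involution_inv sS) mulKg. Qed.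

Lemma mem_cell_mul v w g :
  g \in cell (v * w) -> exists g' h', [/\ g' \in cell v, h' \in cell w & g = g' * h'].
Proof.
move=> /mem_cell[b [x [b' [bB xvw b'B ->]]]].
move: xvw => /mulsgP[y z yv zw ->].
exists (b * y), (z * b'); split; last by rewrite !mulgA.
  by rewrite cellMl // coset_cell.
by rewrite cellMr // coset_cell.
Qed.

(** Uniqueness in the Bruhat decomposition, by induction on the smaller length, that of [w]. If
    [w = s * u] with [u] shorter, multiplication by [s] shows that the cell of [u] is that of [v] or
    of [s * v]; by induction [u] is [v], which the lengths exclude, or [s * v], which gives
    [w = v]. *)
Lemma cell_inj v w : v \in W -> w \in W -> cell v = cell w -> v = w.
Proof.
move: {2}(word_length S w) (erefl (word_length S w)) => q.
wlog vw : v w q / (word_length S w <= word_length S v)%N.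
  move=> IH wq vW wW vwE.
  have [le|/ltnW le] := leqP (word_length S w) (word_length S v).
    exact: IH wq _ _ _.
  by apply/esym; apply: IH (erefl _) _ _ _.
elim: q v w vw => [|q IHq] v w vw wq vW wW vwE.
  have w1 := word_length_eq0 wW wq; rewrite w1 cell1 in vwE *.
  have [x xN vE] : exists2 x, x \in N & v = coset H x.
    by have /morphimP[x _ xN ->] := memWN vW; exists x.
  rewrite vE coset_id // inE xN andbT -vwE coset_cell // vE mem_coset //.
have [s [u [sS uW wE uq]]] := word_length_Sl wW wq.
have sW := mem_gen sS.
have uE : u = s * w by rewrite wE simpleK.
have [y yu] : exists y, y \in u by exists (repr u); apply: mem_repr_coset.
have [x xs] : exists x, x \in s by exists (repr s); apply: mem_repr_coset.
have yuv : y \in cell u by apply: coset_cell.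
have xyv : x * y \in cell v.
  by rewrite vwE wE coset_cell // mem_cosetM ?memWN.
have x's : x^-1 \in cell s.
  by rewrite -(involution_inv sS) cellV ?memWN // coset_cell.
have := cell_mul_simple sS vW x's xyv; rewrite mulKg => /orP[yv|ysv].
  have uv : v = u.
    apply: IHq => //; first by rewrite uq (leq_trans _ vw) // wq.
    exact: cell_cell_sub yv yuv.
  by move: vw; rewrite uv uq wq ltnn.
apply: (mulgI s); rewrite -uE; apply: IHq => //.
- have := word_lengthMl sS (groupM sW vW); rewrite simpleK // => le.
  by rewrite uq -ltnS (leq_trans _ le) // (leq_trans _ vw) // wq.
- exact: groupM.
- by apply: cell_cell_sub ysv yuv => //; apply: groupM.
Qed.

Lemma cell_disjoint v w g : v \in W -> w \in W ->
  g \in cell v -> g \in cell w -> v = w.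
Proof. by move=> vW wW gv gw; apply: cell_inj => //; apply: cell_cell_sub gv gw. Qed.

(** By the exchange axiom only [g * h \in cell w] must be excluded. Write [w = v * t] with [v]
    shorter. By induction a certain [k] lies in [cell (s * v)], while its inverse lies in the
    product of the cells of [t] and [w^-1], so [k] is also in [cell w] or [cell v]. Disjointness
    gives [s * v = w], against the lengths, or [s = 1]. *)
Lemma cell_mul_length_le s w g h : s \in S -> w \in W ->
  (word_length S w <= word_length S (s * w)%g)%N ->
  g \in cell s -> h \in cell w -> g * h \in cell (s * w).
Proof.
move: {2}(word_length S w) (erefl (word_length S w)) => q.
elim: q w g h => [|q IHq] w g h wq sS wW ws gs hw.
  rewrite (word_length_eq0 wW wq) in hw *; rewrite mulg1 cellMr //.
  by rewrite -cell1.
have [ghw|//] := orP (cell_mul_simple sS wW gs hw).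
have [v [t [tS vW wE vq]]] := word_length_Sr wW wq.
have sW := mem_gen sS; have tW := mem_gen tS.
have /mem_cell[b [z [b' [bB zw b'B hE]]]] := hw.
move: zw; rewrite wE => /mulsgP[x y xv yt zE].
(* The induction hypothesis applies because right multiplication by [t] changes the length by at
   most one. *)
have kv : g * b * x \in cell (s * v).
  apply: IHq => //; last by rewrite coset_cell.
    rewrite vq -ltnS -wq (leq_trans ws) // wE mulgA word_lengthMr //.
    exact: groupM.
  by rewrite cellMr.
have kV : (g * b * x)^-1 = y * b' * (g * h)^-1.
  by apply: (mulIg (g * h)); rewrite mulgKV hE zE !invMg -!mulgA !mulKg.
have tw : t * w^-1 = v^-1 by rewrite wE invMg involution_inv // simpleK.
have yt' : y * b' \in cell t by rewrite cellMr // coset_cell.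
have ghw' : (g * h)^-1 \in cell w^-1 by rewrite cellV ?memWN.
have sv : s * v \in W by apply: groupM.
have := cell_mul_simple tS (groupVr wW) yt' ghw'.
rewrite tw -kV !cellV ?memWN //.
move=> /orP[kw|kv'].
  have svw : s * v = w by apply: cell_disjoint kv kw.
  by move: ws; rewrite -svw simpleK // svw vq wq ltnn.
have /(canRL (mulgK v)) : s * v = v by apply: cell_disjoint kv kv'.
by rewrite mulgV => s1; have := simple_neq1 sS; rewrite s1 eqxx.
Qed.

(** Thickness provides two elements of [cell s] with product in [cell s]. Multiplying by an element
    of [cell (s * w)] moves this to [cell w], because [cell_mul_length_le] applies to [s * w]. *)
Lemma cell_mul_length_ge s w : s \in S -> w \in W ->
    (word_length S (s * w)%g <= word_length S w)%N ->
  exists g h, [/\ g \in cell s, h \in cell w & g * h \in cell w].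
Proof.
move=> sS wW le; have sW := mem_gen sS; have swW := groupM sW wW.
have [g1 [g2 [g1s g2s g12s]]] :
    exists g1 g2, [/\ g1 \in cell s, g2 \in cell s & g1 * g2 \in cell s].
  have /subsetPn[_ /mulsgP[_ y /mulsgP[x b xs bB ->] ys ->] xby] := BN_thick BN sS.
  have g1s : x * b \in cell s by rewrite cellMr // coset_cell.
  have g2s := coset_cell ys.
  exists (x * b), y; split=> //.
  have /orP[//|] := cell_mul_simple sS sW g1s g2s.
  by rewrite -{1}(involution_inv sS) mulVg cell1 (negPf xby).
have [h hsw] : exists h, h \in cell (s * w).
  by exists (repr (s * w)); apply/coset_cell/mem_repr_coset.
have mulC g : g \in cell s -> g * h \in cell w.
  by move=> gs; rewrite -(simpleK w sS) cell_mul_length_le // simpleK.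
exists g1, (g2 * h); rewrite g1s mulC //; split=> //.
by rewrite mulgA mulC.
Qed.

(** If the lengths were equal, both preceding lemmas would apply, and some product would lie in the
    cells of [w] and of [s * w]. *)
Lemma word_length_simpleM_neq s w : s \in S -> w \in W ->
  word_length S (s * w)%g != word_length S w.
Proof.
move=> sS wW; apply/eqP=> eq_len; have swW := groupM (mem_gen sS) wW.
have [|g [h [gs hw ghw]]] := cell_mul_length_ge sS wW; first by rewrite eq_len.
have ghsw : g * h \in cell (s * w) by rewrite cell_mul_length_le ?eq_len.
have /(canRL (mulgK w)) : s * w = w by apply: cell_disjoint ghsw ghw.
by rewrite mulgV => s1; have := simple_neq1 sS; rewrite s1 eqxx.
Qed.

Lemma odd_word_length_simpleM s w : s \in S -> w \in W ->
  odd (word_length S (s * w)%g) = ~~ odd (word_length S w).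
Proof.
move=> sS wW; have := word_length_simpleM_neq sS wW.
have := word_lengthMl sS wW; have := word_lengthMl sS (groupM (mem_gen sS) wW).
rewrite simpleK // => le1 le2 neq.
have [lt|gt|/eqP] := ltngtP (word_length S (s * w)) (word_length S w).
- have -> : word_length S w = (word_length S (s * w)%g).+1.
    by apply/eqP; rewrite eqn_leq le1.
  by rewrite /= negbK.
- suff -> : word_length S (s * w) = (word_length S w).+1 by [].
  by apply/eqP; rewrite eqn_leq le2.
- by rewrite (negPf neq).
Qed.

Lemma sub_cell (P : {group gT}) w g : w \in W -> B \subset P ->
  g \in cell w -> (cell w \subset P) = (g \in P).
Proof.
move=> /memWN wN /subsetP BP gw; apply/subsetP/idP=> [-> //|].
have /mem_cell[b [x [b' [bB xw b'B ->]]]] := gw => xP h.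
move=> /mem_cell[c [y [c' [cB yw c'B ->]]]].
rewrite (groupMr _ (BP _ b'B)) (groupMl _ (BP _ bB)) in xP.
have yxP := BP _ (coset_divB wN xw yw).
by rewrite !groupM ?(BP _ cB) ?(BP _ c'B) // -(mulgKV x y) groupM.
Qed.

(* [C(s) C(w)] meets [C(w)], so that [s] lies in [B x B x^-1 B]. *)
Lemma conj_sub_simple (P : {group gT}) s w x : s \in S -> w \in W ->
    (word_length S (s * w)%g <= word_length S w)%N -> x \in w ->
    B \subset P -> B :^ x^-1 \subset P ->
  cell s \subset P.
Proof.
move=> sS wW le xw sBP /subsetP BxP; have /subsetP BP := sBP.
have wN := memWN wW.
have [g [h [gs hw ghw]]] := cell_mul_length_ge sS wW le.
rewrite (sub_cell _ _ gs) ?mem_gen // -(mulgK h g).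
have /mem_cell[b [y [b' [bB yw b'B hE]]]] := hw.
have /mem_cell[c [z [c' [cB zw c'B ->]]]] := ghw.
have -> : c * z * c' * h^-1 = c * (z * x^-1) * (c' * b'^-1) ^ x^-1
    * (y * x^-1)^-1 * b^-1.
  by rewrite hE conjgE !invMg !invgK !mulgA !mulgKV.
have zxP := BP _ (coset_divB wN xw zw); have yxP := BP _ (coset_divB wN xw yw).
have cxP : (c' * b'^-1) ^ x^-1 \in P by rewrite BxP ?memJ_conjg ?groupM ?groupV.
rewrite (groupMr _ (groupVr (BP _ bB))) (groupMr _ (groupVr yxP)).
by rewrite (groupMr _ cxP) (groupMr _ zxP) BP.
Qed.

(** Peels a reduced word of [w] from the left: its first letter [s] has its cell in [P] by
    [conj_sub_simple], and conjugation by a representative of [s], now in [P], preserves the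
    hypothesis for the rest of the word. *)
Lemma conj_sub_gen (P : {group gT}) w x : w \in W -> x \in w ->
    B \subset P -> B :^ x^-1 \subset P ->
  w \in <<[set s in S | cell s \subset P]>>.
Proof.
move=> wW xw sBP; move: {2}(word_length S w) (erefl (word_length S w)) => q.
elim: q w x wW xw => [|q IHq] w x wW xw wq BxP.
  by rewrite (word_length_eq0 wW wq) group1.
have [s [v [sS vW wE vq]]] := word_length_Sl wW wq.
have vE : s * w = v by rewrite wE simpleK.
have sP : cell s \subset P.
  by apply: (conj_sub_simple sS wW _ xw); rewrite // vE vq wq.
rewrite wE; apply: groupM; first by rewrite mem_gen // inE sS.
pose y := repr s; have ys : y \in s := mem_repr_coset s.
have yP : y \in P by rewrite -(sub_cell (mem_gen sS) sBP (coset_cell ys)).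
have sN := memWN (mem_gen sS).
have yxv : y^-1 * x \in v.
  rewrite -vE -{1}(involution_inv sS); apply: mem_cosetM => //.
  - by rewrite groupV.
  - exact: memWN.
  - exact: mem_cosetV.
by apply: IHq yxv vq _ => //; rewrite invMg invgK conjsgM -(conjGid yP) conjSg.
Qed.

Lemma mem_gen_simple_sub (P : {group gT}) w x : w \in W -> x \in w ->
    B \subset P -> w \in <<[set s in S | cell s \subset P]>> -> x \in P.
Proof.
move=> wW xw BP wP; rewrite -(sub_cell wW BP (coset_cell xw)).
move: w wP wW {x xw}; apply: gen_ind => [|s v /setIdP[sS sP] vP IHv svW].
  by rewrite cell1.
have vW : v \in W by rewrite -(groupMl _ (mem_gen sS)).
have sW := mem_gen sS.
have xs : repr s \in s := mem_repr_coset s; have yv : repr v \in v := mem_repr_coset v.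
have xyw := mem_cosetM (memWN sW) (memWN vW) xs yv.
rewrite (sub_cell svW BP (coset_cell xyw)) groupM //.
  by rewrite -(sub_cell sW BP (coset_cell xs)).
by rewrite -(sub_cell vW BP (coset_cell yv)) IHv.
Qed.

(** The generated group is taken so that the value is a group for every [I]; for [I \subset S] the
    union of cells is already closed under products, by [parabolicP]. *)
Definition parabolic (I : {set coset_of H}) : {group gT} :=
  <<\bigcup_(w in <<I>>) cell w>>%G.

Lemma parabolicP (I : {set coset_of H}) g : I \subset S ->
  reflect (exists2 w, w \in <<I>> & g \in cell w) (g \in parabolic I).
Proof.
move=> IS; suff UG : group_set (\bigcup_(w in <<I>>) cell w).
  by rewrite /= (gen_set_id UG); apply: bigcupP.
apply/group_setP; split=> [|g' h' /bigcupP[v vI gv] hU].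
  by apply/bigcupP; exists 1; rewrite ?group1 // cell1.
move: v vI g' gv; apply: gen_ind => [|s v sI vI IHv] g'.
  rewrite cell1 => g'B; have /bigcupP[w wI hw] := hU.
  by apply/bigcupP; exists w; rewrite ?cellMl.
move=> /mem_cell_mul[g1 [h1 [g1s h1v ->]]].
have /bigcupP[w wI hw] := IHv _ h1v; rewrite -mulgA.
have sS := subsetP IS s sI; have wW := subsetP (genS IS) w wI.
have /orP[?|?] := cell_mul_simple sS wW g1s hw; apply/bigcupP.
  by exists w.
by exists (s * w); rewrite // groupM // mem_gen.
Qed.

End DoubleCosets.

(** * Standard parabolic subgroups and their correspondence with subsets of [S] *)

Section Parabolics.
Variables (gT : finGroupType) (B N : {group gT}).
Variable (S : {set coset_of (B :&: N)}).
Hypothesis BN : BN_axioms S.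

Local Notation W := <<S>>.
Implicit Types (I J : {set coset_of (B :&: N)}) (P : {group gT}).

(* Compares, for [w = s], the length functions of [S] and of [I]. *)
Lemma mem_gen_simple I s : I \subset S -> s \in S -> s \in <<I>> -> s \in I.
Proof.
move=> IS sS sI; have BNI := BN_axioms_sub IS BN.
have sW := mem_gen sS; have s1 := simple_neq1 BN sS.
case lenI: (word_length I s) => [|q].
  by rewrite (word_length_eq0 sI lenI) eqxx in s1.
have [t [v [tI vI sE vq]]] := word_length_Sl sI lenI.
have tS := subsetP IS t tI; have tW := mem_gen tS.
have [->//|ts] := eqVneq s t.
have vE : t * s = v by rewrite sE (simpleK BNI).
have [|g [h [gt hs ghs]]] := cell_mul_length_ge BNI tI sI.
  by rewrite vE vq lenI.
have tsW : t * s \in W by apply: groupM.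
have ghts : g * h \in cell (t * s).
  apply: (cell_mul_length_le BN) => //.
  apply: (@leq_trans 1).
    by have := word_lengthMl sS (group1 W); rewrite mulg1 word_length1.
  rewrite lt0n; apply: contraNneq ts => /(word_length_eq0 tsW) ts1.
  by rewrite -(simpleK BN s tS) ts1 mulg1.
have /(canRL (mulgK s)) := cell_disjoint BN tsW sW ghts ghs.
by rewrite mulgV => t1; have := simple_neq1 BN tS; rewrite t1 eqxx.
Qed.

Lemma B_sub_parabolic I : I \subset S -> B \subset parabolic I.
Proof.
move=> IS; apply/subsetP=> b bB; apply/(parabolicP BN _ IS).
by exists 1; rewrite ?group1 // cell1.
Qed.

Lemma mem_parabolic I w x : I \subset S -> w \in W -> x \in w ->
  (x \in parabolic I) = (w \in <<I>>).
Proof.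
move=> IS wW xw; apply/(parabolicP BN _ IS)/idP=> [[v vI xv]|wI]; last first.
  by exists w => //; apply: coset_cell.
have vW := subsetP (genS IS) v vI.
by rewrite (cell_disjoint BN wW vW (coset_cell xw) xv).
Qed.

Lemma mem_parabolic_simple I s x : I \subset S -> s \in S -> x \in s ->
  (x \in parabolic I) = (s \in I).
Proof.
move=> IS sS xs; rewrite (mem_parabolic IS (mem_gen sS) xs).
by apply/idP/idP=> [/(mem_gen_simple IS sS)//|/mem_gen].
Qed.

Lemma parabolic_subset I J : I \subset S -> J \subset S ->
  (parabolic I \subset parabolic J) = (I \subset J).
Proof.
move=> IS JS; apply/idP/idP=> [IJ|IJ]; last first.
  by apply: genS; apply/bigcupsP=> w wI; apply: bigcup_sup; apply: subsetP (genS IJ) w wI.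
apply/subsetP=> s sI; have sS := subsetP IS s sI.
rewrite -(mem_parabolic_simple JS sS (mem_repr_coset s)) (subsetP IJ) //.
by rewrite (mem_parabolic_simple IS sS) // mem_repr_coset.
Qed.

Lemma parabolic_inj I J : I \subset S -> J \subset S ->
  parabolic I = parabolic J -> I = J.
Proof.
move=> IS JS IJ; apply/eqP; rewrite eqEsubset.
by rewrite -(parabolic_subset IS JS) -(parabolic_subset JS IS) IJ subxx.
Qed.

Lemma conj_sub_mem P w x : w \in W -> x \in w -> B \subset P ->
  B :^ x^-1 \subset P -> x \in P.
Proof.
move=> wW xw BP BxP.
by apply: (mem_gen_simple_sub BN wW xw BP); apply: (conj_sub_gen BN wW xw).
Qed.

(** The set [I] collects the simple [s] whose cell lies in [P]. If [P] meets the cell of [w], it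
    contains a representative of [w], hence the corresponding conjugate of [B], and [conj_sub_gen]
    gives [w \in <<I>>]. *)
Lemma overgroup_parabolic P : B \subset P -> P \subset parabolic S ->
  exists2 I : {set coset_of (B :&: N)}, I \subset S & P = parabolic I.
Proof.
move=> BP PS; pose I := [set s in S | cell s \subset P].
have IS : I \subset S by apply/subsetP=> s /setIdP[].
exists I => //; apply/val_inj/eqP; rewrite /= eqEsubset; apply/andP; split.
  apply/subsetP=> g gP; apply/(parabolicP BN _ IS).
  have /(parabolicP BN _ (subxx S))[w wW gw] := subsetP PS g gP.
  have wP : cell w \subset P by rewrite (sub_cell BN wW BP gw).
  have xw := mem_repr_coset w; have xP := subsetP wP _ (coset_cell xw).
  exists w => //; apply: (conj_sub_gen BN wW xw) => //.
  by rewrite -(conjGid (groupVr xP)) conjSg.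
apply/subsetP=> g /(parabolicP BN _ IS)[w wI]; apply/subsetP.
have wW := subsetP (genS IS) w wI; have xw := mem_repr_coset w.
by rewrite (sub_cell BN wW BP (coset_cell xw)) (mem_gen_simple_sub BN wW xw BP).
Qed.

End Parabolics.

Lemma Tits_system_parabolic (gT : finGroupType) (G B N : {group gT})
    (S : {set coset_of (B :&: N)}) :
  Tits_system G S -> G = parabolic S.
Proof.
move=> T; have BN := Tits_system_BN T.
have BP := B_sub_parabolic BN (subxx S).
have GE := Tits_gen T; have WE := Tits_Weyl_gen T.
apply/val_inj/eqP; rewrite /= -GE eqEsubset; apply/andP; split.
  rewrite join_subG BP; apply/subsetP=> n nN.
  have nw := mem_coset BN nN.
  by rewrite (mem_parabolic BN (subxx S) _ nw) WE mem_quotient.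
apply/subsetP=> g /(parabolicP BN _ (subxx S))[w wW /mem_cell[b [x [b' [bB xw b'B ->]]]]].
have [BG NG] : B \subset B <*> N /\ N \subset B <*> N by rewrite joing_subl joing_subr.
rewrite !groupM ?(subsetP BG _ bB) ?(subsetP BG _ b'B) //.
by rewrite (subsetP NG) // (coset_sub (memWN BN wW)).
Qed.

(** * Simplices of the building described by a chamber and a set of types *)

Section BuildingSimplices.
Variables (gT : finGroupType) (G B N : {group gT}).
Variable (S : {set coset_of (B :&: N)}).
Hypothesis T : Tits_system G S.

Let BN := Tits_system_BN T.
Let GE := Tits_system_parabolic T.
Implicit Types (I J : {set coset_of (B :&: N)}) (P Q : {group gT})
  (s t : coset_of (B :&: N)).

Lemma Tits_N_sub : N \subset G.
Proof. by rewrite -(Tits_gen T) joing_subr. Qed.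

(** The Bruhat decomposition reduces to a representative of an element of [<<S>>]. Consequently two
    conjugate subgroups that both contain [B] are equal, which makes the type of a vertex well
    defined. *)
Lemma conj_B_sub_mem P g : g \in G -> B \subset P -> B :^ g \subset P -> g \in P.
Proof.
move=> gG sBP; have /subsetP BP := sBP.
move: gG; rewrite GE => /(parabolicP BN _ (subxx S))[w wW].
move=> /mem_cell[b [x [b' [bB xw b'B ->]]]].
rewrite -mulgA conjsgM (conjGid bB) conjsgM.
rewrite (groupMl _ (BP _ bB)) (groupMr _ (BP _ b'B)).
rewrite -{1}(conjGid (BP _ b'B)) conjSg => BxP.
rewrite -groupV; apply: (conj_sub_mem BN (groupVr wW)) => //.
  by rewrite (mem_cosetV BN) ?(memWN BN).
by rewrite invgK.
Qed.

(** The vertex of type [s] of the chamber [B :^ g]; a maximal parabolic subgroup omits exactly one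
    simple generator, its type. *)
Definition vertex g s : {group gT} := (parabolic (S :\ s) :^ g)%G.

Lemma B_sub_vertex g s : B :^ g \subset vertex g s.
Proof. by rewrite conjSg (B_sub_parabolic BN) // subsetDl. Qed.

Lemma vertex_type g h s t : g \in G -> h \in G -> s \in S -> t \in S ->
  vertex g s = vertex h t -> s = t.
Proof.
move=> gG hG sS tS /(congr1 val) /= E.
have {}E : parabolic (S :\ s) :^ (g * h^-1) = parabolic (S :\ t).
  by rewrite conjsgM E conjsgK.
have DS u : S :\ u \subset S := subsetDl _ _.
have ghM : g * h^-1 \in parabolic (S :\ t).
  apply: conj_B_sub_mem; rewrite ?groupM ?groupV ?(B_sub_parabolic BN) //.
  by rewrite -E conjSg (B_sub_parabolic BN).
have /(parabolic_inj BN (DS s) (DS t)) : parabolic (S :\ s) = parabolic (S :\ t).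
  by apply/val_inj/(act_inj 'Js (g * h^-1)); rewrite /= E conjGid.
by move=> /setP/(_ s); rewrite !inE eqxx sS !andbT => st; apply/eqP/negbFE; rewrite -st.
Qed.

Lemma conj_overgroup Q g : g \in G -> B :^ g \subset Q -> Q \subset G ->
  exists2 I : {set coset_of (B :&: N)}, I \subset S & Q = (parabolic I :^ g)%G.
Proof.
move=> gG BQ QG.
have [||I IS QE] := @overgroup_parabolic _ _ _ _ BN (Q :^ g^-1)%G.
- by rewrite /= -sub_conjg.
- by rewrite -GE /= sub_conjgV conjGid.
by exists I => //; apply/val_inj; rewrite -QE /= conjsgKV.
Qed.

Lemma conj_parabolic_proper I g : g \in G -> I \subset S ->
  proper_parabolic G B (parabolic I :^ g)%G = (I \proper S).
Proof.
move=> gG IS; rewrite /proper_parabolic.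
have -> : [exists h in G, B :^ h \subset parabolic I :^ g].
  by apply/existsP; exists g; rewrite gG conjSg (B_sub_parabolic BN).
rewrite andbT /= -{1}(conjGid gG) properJ.
rewrite !properE {1 2}GE !(parabolic_subset BN) //.
Qed.

Lemma maximal_parabolicP P g : g \in G -> B :^ g \subset P ->
  reflect (exists2 s, s \in S & P = vertex g s) (maximal_parabolic G B P).
Proof.
move=> gG BP; have DS u : S :\ u \subset S := subsetDl _ _.
apply: (iffP maxgroupP) => [[pP maxP]|[s sS ->]].
  have PG : P \subset G by case/andP: pP => /proper_sub.
  have [I IS PE] := conj_overgroup gG BP PG.
  have /properP[_ [s sS sI]] : I \proper S by rewrite -(conj_parabolic_proper gG IS) -PE.
  exists s => //; apply/val_inj/esym/maxP.
    by rewrite conj_parabolic_proper // properD1.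
  by rewrite PE conjSg (parabolic_subset BN) // subsetD1 IS.
split=> [|Q pQ sQ]; first by rewrite conj_parabolic_proper // properD1.
have QG : Q \subset G by case/andP: pQ => /proper_sub.
have BQ := subset_trans (B_sub_vertex g s) sQ.
have [I IS QE] := conj_overgroup gG BQ QG.
rewrite QE conj_parabolic_proper // in pQ.
rewrite QE conjSg (parabolic_subset BN) // in sQ.
rewrite QE; congr (_ :^ g); congr (gval (parabolic _)); apply/eqP.
rewrite eqEsubset sQ andbT subsetD1 IS /=.
apply: contraTN pQ => sI; rewrite properE negb_and negbK -(setD1K sS).
by rewrite subUset sub1set sI sQ orbT.
Qed.

Lemma parabolic_simplexE (I : {set coset_of (B :&: N)}) g : g \in G -> I \subset S ->
  parabolic_simplex G B (parabolic I :^ g)%G = [set vertex g s | s in S :\: I].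
Proof.
move=> gG IS; have BI : B :^ g \subset parabolic I :^ g.
  by rewrite conjSg (B_sub_parabolic BN).
apply/setP=> P; rewrite inE; apply/andP/imsetP=> [[maxP IP]|[s /setDP[sS sI] ->]].
  have BP := subset_trans BI IP.
  have [s sS PE] := maximal_parabolicP gG BP maxP.
  exists s => //; rewrite inE sS andbT; move: IP.
  by rewrite PE conjSg (parabolic_subset BN) ?subsetDl // subsetD1 => /andP[].
split; first by apply/(maximal_parabolicP gG (B_sub_vertex g s)); exists s.
by rewrite conjSg (parabolic_subset BN) ?subsetDl // subsetD1 IS.
Qed.

(** The simplices are the nonempty faces of the chambers [B :^ g]. The set of types [J] is the
    complement in [S] of the subset that defines the parabolic subgroup. *)
Lemma buildingP (t : {set {group gT}}) :
  reflect (exists g (J : {set coset_of (B :&: N)}),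
    [/\ g \in G, J \subset S, J != set0 & t = [set vertex g s | s in J]])
  (t \in building G B).
Proof.
apply: (iffP imsetP) => [[P pP ->]|[g [J [gG JS J0 ->]]]].
  rewrite inE in pP.
  have /andP[/proper_sub PG /existsP[g /andP[gG BP]]] := pP.
  have [I IS PE] := conj_overgroup gG BP PG.
  exists g, (S :\: I); rewrite subsetDl PE parabolic_simplexE //; split=> //.
  by move: pP; rewrite PE conj_parabolic_proper // properE setD_eq0 => /andP[].
exists (parabolic (S :\: J) :^ g)%G.
  rewrite inE conj_parabolic_proper ?subsetDl // properE subsetDl /=.
  have /set0Pn[s sJ] := J0; apply/subsetPn; exists s; first exact: subsetP sJ.
  by rewrite inE sJ.
by rewrite parabolic_simplexE ?subsetDl // setDDr setDv set0U (setIidPr JS).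
Qed.

End BuildingSimplices.

End TitsSystems.

(** * The building *)

Section BuildingComplex.
Variables (gT : finGroupType) (G B N : {group gT}).
Variables (S : {set coset_of (B :&: N)}) (l : nat).
Hypotheses (T : Tits_system G S) (rankS : #|S| = l.+1).

Local Notation X := (building G B).
Local Notation vert := (vertex S).
Implicit Types J : {set coset_of (B :&: N)}.

Let vert_inj g : g \in G -> {in S &, injective (vert g)}.
Proof. by move=> gG s t sS tS; apply: (vertex_type T). Qed.

Let card_vert g J : g \in G -> J \subset S -> #|[set vert g s | s in J]| = #|J|.
Proof.
by move=> gG /subsetP JS; apply: card_in_imset => s t /JS ? /JS; apply: vert_inj.
Qed.

Lemma building_subset (s t : {set {group gT}}) :
  t \in X -> s \subset t -> s != set0 -> s \in X.
Proof.
move=> /(buildingP T)[g [J [gG JS _ ->]]] /subsetP st s0.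
pose K := [set u in J | vert g u \in s].
have sE : s = [set vert g u | u in K].
  apply/setP=> v; apply/idP/imsetP=> [vs|[u /setIdP[_ us] ->//]].
  by have /imsetP[u uJ vE] := st v vs; exists u; rewrite // inE uJ -vE.
apply/(buildingP T); exists g, K; split=> //.
  by apply: subset_trans JS; apply/subsetP=> u /setIdP[].
by apply: contraNneq s0 => K0; rewrite sE K0 imset0.
Qed.

Lemma building_card_le s : s \in X -> (#|s| <= l.+1)%N.
Proof.
move=> /(buildingP T)[g [J [gG JS _ ->]]].
by rewrite card_vert // -rankS subset_leq_card.
Qed.

Lemma building_chamber s : s \in X ->
  exists2 c, c \in simplices X l & s \subset c.
Proof.
move=> /(buildingP T)[g [J [gG JS _ ->]]].
exists [set vert g u | u in S]; last exact: imsetS.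
rewrite inE card_vert // rankS eqxx andbT; apply/(buildingP T).
by exists g, S; split=> //; rewrite -card_gt0 rankS.
Qed.

Lemma building_dim : Defs.dim X = l.
Proof.
have [c] : exists c, c \in simplices X l.
  exists [set vert 1%g u | u in S].
  rewrite inE card_vert // rankS eqxx andbT; apply/(buildingP T).
  by exists 1%g, S; split=> //; rewrite -card_gt0 rankS.
rewrite inE => /andP[cX /eqP cl]; rewrite /Defs.dim.
suff -> : (\max_(s in X) #|s|)%N = l.+1 by [].
apply/eqP; rewrite eqn_leq; apply/andP; split.
  by apply/bigmax_leqP=> s; apply: building_card_le.
by rewrite -cl; apply: leq_bigmax_cond.
Qed.

End BuildingComplex.

(** * The alternating sphere in the standard apartment *)

Section ApartmentSphere.
Variables (R : realType) (gT : finGroupType) (G B N : {group gT}).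
Variables (S : {set coset_of (B :&: N)}) (l i : nat).
Hypotheses (T : Tits_system G S) (rankS : #|S| = l.+1) (il : (i < l)%N).

Let BN := Tits_system_BN T.
Local Notation X := (building G B).
Local Notation W := (coset_of (B :&: N)).

(** These [i + 2] distinct types exist because [i < l] and [S] has [l + 1] elements. The type
    [tau ord0] is kept for the apex of the cone, and the other [i + 1] form [J]. *)
Let tau (m : 'I_i.+2) : W := nth 1%g (enum S) m.

Let tau_size (m : 'I_i.+2) : (m < size (enum S))%N.
Proof. by rewrite -cardE rankS (leq_trans (ltn_ord m)). Qed.

Let tauS m : tau m \in S.
Proof. by rewrite -mem_enum mem_nth. Qed.

Let tau_inj : injective tau.
Proof.
by move=> m n /eqP; rewrite nth_uniq ?enum_uniq // => /eqP/val_inj.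
Qed.

Let J : {set W} := [set tau (lift ord0 m) | m : 'I_i.+1].

Let JS : J \subset S.
Proof. by apply/subsetP=> _ /imsetP[m _ ->]. Qed.

Let JW : {subset <<J>>%g <= <<S>>%g}.
Proof. exact/subsetP/genS/JS. Qed.

(** Conjugation is a right action: the chamber of [w] is [B :^ repr w], and its neighbour across the
    face that omits type [s] is the chamber of [s * w]. *)
Let vert (w : W) (s : W) := vertex S (repr w) s.

Let repr_G w : w \in <<S>>%g -> repr w \in G.
Proof.
move=> wS; apply: (subsetP (Tits_N_sub T)).
exact: (coset_sub (memWN BN wS) (mem_repr_coset w)).
Qed.

Let vert_simple s t w : s \in S -> t \in S -> s != t -> w \in <<S>>%g ->
  vert (s * w)%g t = vert w t.
Proof.
move=> sS tS st wS; apply/val_inj; pose P := parabolic (S :\ t).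
rewrite -[LHS]/(P :^ repr (s * w)%g)%g -[RHS]/(P :^ repr w)%g.
have sW := mem_gen sS; have swW := groupM sW wS.
have DS : S :\ t \subset S := subsetDl _ _.
(* Up to a factor in [B], the representative of [s * w] is the product of those of [s] and [w]; that
   of [s] lies in the parabolic subgroup of type [t] because [s] differs from [t]. *)
have -> : repr (s * w)%g = (repr (s * w)%g * (repr s * repr w)^-1 * repr s * repr w)%g.
  by rewrite invMg !mulgA !mulgKV.
rewrite conjsgM conjGid // groupM //; last first.
  by rewrite (mem_parabolic_simple BN DS sS (mem_repr_coset s)) !inE st.
apply: (subsetP (B_sub_parabolic BN DS)).
apply: (coset_divB BN (memWN BN swW)); last exact: mem_repr_coset.
by apply: (mem_cosetM BN); rewrite ?(memWN BN) // mem_repr_coset.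
Qed.

Let cone (w : W) : i.+2.-tuple {group gT} := [tuple vert w (tau m) | m < i.+2].
Let sigma (w : W) : i.+1.-tuple {group gT} := face (cone w) ord0.
Let sigma_nth w m : tnth (sigma w) m = vert w (tau (lift ord0 m)).
Proof. by rewrite !tnth_mktuple. Qed.

Let ordered_vert n (u : 'I_n.+1 -> W) w : injective u -> (forall m, u m \in S) ->
  w \in <<S>>%g -> ordered_simplex X [tuple vert w (u m) | m < n.+1].
Proof.
move=> u_inj uS wS; pose K := [set u m | m : 'I_n.+1].
have KS : K \subset S by apply/subsetP=> _ /imsetP[m _ ->].
have setE : [set x in [tuple vert w (u m) | m < n.+1]] = [set vert w s | s in K].
  apply/setP=> x; rewrite inE; apply/tnthP/imsetP=> [[m ->]|[_ /imsetP[m _ ->] ->]].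
    by exists (u m); rewrite ?imset_f // tnth_mktuple.
  by exists m; rewrite tnth_mktuple.
rewrite /ordered_simplex setE inE; apply/andP; split.
  apply/(buildingP T); exists (repr w), K; rewrite repr_G //; split=> //.
  by apply/set0Pn; exists (u ord0); apply: imset_f.
rewrite card_in_imset ?card_imset ?card_ord // => s t /(subsetP KS) sS /(subsetP KS) tS.
by apply: (vertex_type T) => //; apply: repr_G.
Qed.

Let cone_ordered w : w \in <<S>>%g -> ordered_simplex X (cone w).
Proof. exact: ordered_vert. Qed.

Let sigma_ordered w : w \in <<S>>%g -> ordered_simplex X (sigma w).
Proof.
move=> wS; have -> : sigma w = [tuple vert w (tau (lift ord0 m)) | m < i.+1].
  by apply: eq_from_tnth => m; rewrite sigma_nth tnth_mktuple.
by apply: ordered_vert => // m n /tau_inj/lift_inj.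
Qed.

Let sgn (w : W) : R := (-1) ^+ word_length S w.

Let sgn_simple s w : s \in S -> w \in <<S>>%g -> sgn (s * w)%g = - sgn w.
Proof.
move=> sS wS; rewrite /sgn -signr_odd (odd_word_length_simpleM BN) //.
by rewrite signrN signr_odd.
Qed.

(* The faces of the cone other than [sigma w] cancel in pairs [w], [tau m * w]. *)
Let sphere_cocycle (z : cochain R X i) : coboundary z = 0 ->
  \sum_(w in <<J>>%g) sgn w * z (sigma w) = 0.
Proof.
move=> dz; have zE w : w \in <<J>>%g ->
    z (sigma w) = \sum_(m < i.+1) (-1) ^+ m * z (face (cone w) (lift ord0 m)).
  move=> wJ; have := congr1 (fun c : cochain R X i.+1 => c (cone w)) dz.
  rewrite !ffunE cone_ordered ?JW // big_ord_recl expr0 mul1r => /eqP.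
  rewrite addr_eq0 => /eqP ->; rewrite -sumrN; apply: eq_bigr => m _.
  by rewrite -mulNr lift0 exprS mulN1r opprK.
rewrite (eq_bigr _ (fun w wJ => congr1 ( *%R (sgn w)) (zE w wJ))).
under eq_bigr do rewrite mulr_sumr.
rewrite exchange_big big1 //= => m _.
set A := \sum_(w in _) _; have tJ : tau (lift ord0 m) \in J by apply: imset_f.
suff : A = - A by move/eqP; rewrite -addr_eq0 -mulr2n mulrn_eq0 /= => /eqP.
rewrite {1}/A (reindex_inj (mulgI (tau (lift ord0 m)))) /= -sumrN.
apply: eq_big => [w|w]; rewrite groupMl ?(mem_gen tJ) // => wJ.
have wS := JW wJ; rewrite sgn_simple // mulNr; congr (- (_ * (_ * z _))).
apply: eq_from_tnth => n; rewrite !tnth_mktuple vert_simple //.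
by rewrite (inj_eq tau_inj) neq_lift.
Qed.

Let weight_X := weight_gt0 (building_chamber T rankS) (building_dim T rankS).

(** Division by the weight cancels the weight in [cochain_dot], so that pairing with [sphere] is the
    signed evaluation on the simplices [sigma w]. *)
Let bump (t : i.+1.-tuple {group gT}) : R :=
  (weight X [set x in t])%:R^-1 * \sum_(w in <<J>>%g) sgn w * (t == sigma w)%:R.

Let sphere : cochain R X i := antisymmetrize X bump.

Let sphere_dot (z : cochain R X i) :
  cochain_dot z sphere = \sum_(w in <<J>>%g) sgn w * z (sigma w).
Proof.
rewrite antisymmetrize_adjoint.
transitivity (\sum_t \sum_(w in <<J>>%g) sgn w * (z t * (t == sigma w)%:R)).
  apply: eq_bigr => t _; rewrite /bump.
  have [tX|/(cochain_out z)->] := boolP (ordered_simplex X t); last first.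
    by rewrite mul0r mulr0 big1 // => w _; rewrite mul0r mulr0.
  rewrite (mulrCA (z t)) mulVKf ?weight_neq0 // mulr_sumr.
  by apply: eq_bigr => w _; rewrite mulrCA.
rewrite exchange_big; apply: eq_bigr => w _ /=; rewrite (bigD1 (sigma w)) //=.
by rewrite eqxx mulr1 big1 ?addr0 // => t /negPf->; rewrite !mulr0.
Qed.

Let vert_type v w s t : v \in <<S>>%g -> w \in <<S>>%g -> s \in S -> t \in S ->
  vert v s = vert w t -> s = t.
Proof. by move=> vS wS sS tS; apply: (vertex_type T) => //; apply: repr_G. Qed.

(** Guarantees that nothing cancels the term of [sigma 1] in the sphere. Comparing types forces
    [p = 1]; the stabilizers of the vertices then force [w = 1]. *)
Let sigma_perm_eq w p : w \in <<J>>%g ->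
  tperms (sigma 1%g) p = sigma w -> p = 1%g /\ w = 1%g.
Proof.
move=> wJ E; have wS := JW wJ.
have p1 : p = 1%g.
  apply/permP=> m; rewrite perm1; apply: (@lift_inj _ ord0); apply: tau_inj.
  apply: (vert_type (group1 _) wS) => //.
  by rewrite -[LHS]sigma_nth -[RHS]sigma_nth -E [RHS]tnth_mktuple.
split=> //; move: E; rewrite p1 tperms1 => E.
have x_in s : s \in J -> repr w \in parabolic (S :\ s).
  case/imsetP=> m _ ->; set s' := tau _; have DS : S :\ s' \subset S := subsetDl _ _.
  apply: (conj_B_sub_mem T (repr_G wS)); first exact: (B_sub_parabolic BN DS).
  apply: subset_trans (B_sub_vertex T (repr w) s') _.
  have E1 : vert w s' = vert 1%g s' by rewrite -[LHS]sigma_nth -E sigma_nth.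
  by rewrite -[vertex _ _ _]/(vert w s') E1 /vert repr_coset1 /vertex /= conjsg1.
(* Otherwise the first letter [s] of a reduced word of [w] in [J] shortens [w], so its cell would
   lie in the parabolic subgroup of [S :\ s]. *)
have BNJ := BN_axioms_sub JS BN; case lenJ: (word_length J w) => [|q].
  exact: word_length_eq0 wJ lenJ.
have [s [v [sJ vJ wE vq]]] := word_length_Sl wJ lenJ.
have sS := subsetP JS s sJ; have DS : S :\ s \subset S := subsetDl _ _.
have BP := B_sub_parabolic BN DS.
have /subsetP/(_ _ (coset_cell (mem_repr_coset s))) : cell s \subset parabolic (S :\ s).
  apply: (conj_sub_simple BNJ sJ wJ _ (mem_repr_coset w) BP).
    by rewrite wE (simpleK BNJ) // -wE vq lenJ.
  by rewrite -(conjGid (groupVr (x_in s sJ))) conjSg.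
by rewrite (mem_parabolic_simple BN DS sS (mem_repr_coset s)) !inE eqxx.
Qed.

Let sphere_neq0 : sphere != 0.
Proof.
have J1 : 1%g \in <<J>>%g := group1 _; have S1 := JW J1.
suff : sphere (sigma 1%g) != 0 by apply: contraNneq => ->; rewrite ffunE.
have bump_perm p : bump (tperms (sigma 1%g) p)
    = (weight X [set x in sigma 1%g])%:R^-1 * (p == 1%g)%:R.
  rewrite /bump set_tperms; congr (_ * _); rewrite (bigD1 1%g) //= big1.
    rewrite addr0 /sgn word_length1 mul1r; congr (nat_of_bool _)%:R.
    by apply/eqP/eqP=> [/(sigma_perm_eq J1)[]//|->]; rewrite tperms1.
  move=> w /andP[wJ w1]; case: eqP => [/(sigma_perm_eq wJ)[_ w1']|_].
    by rewrite w1' eqxx in w1.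
  by rewrite mulr0.
rewrite ffunE sigma_ordered // mulf_neq0 ?invr_neq0 //.
  by rewrite pnatr_eq0 -lt0n fact_gt0.
under eq_bigr do rewrite bump_perm.
rewrite (bigD1 1%g) //= big1 => [|p /negPf->]; last by rewrite !mulr0.
by rewrite odd_perm1 eqxx mul1r mulr1 addr0 invr_neq0 // weight_neq0 ?sigma_ordered.
Qed.

Let sphere_support t : sphere t != 0 ->
  exists2 w, w \in <<J>>%g & [set x in t] = [set x in sigma w].
Proof.
have [/exists_inP[w wJ /eqP tw]|tw] :=
  boolP [exists w in <<J>>%g, [set x in t] == [set x in sigma w]]; first by exists w.
rewrite ffunE; case: ifP => _; last by rewrite eqxx.
rewrite big1 ?mulr0 ?eqxx // => p _.
rewrite /bump big1 ?mulr0 // => w wJ; case: eqP => [E|_]; last by rewrite mulr0.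
by case/exists_inP: tw; exists w; rewrite // -E set_tperms.
Qed.

(** Each simplex of the support has all the types in [J], once each, and a simplex [t] of the
    building has at most one vertex of each type. If the faces omitting the vertices [j] and [k]
    were both in the support, the type of vertex [k] would occur again in the face that omits it. *)
Let sphere_sparse : sparse sphere.
Proof.
move=> t j k; rewrite /ordered_simplex inE => /andP[tX /eqP tc].
move=> /sphere_support[v vJ /setP jE] /sphere_support[w wJ /setP kE].
have t_inj : injective (tnth t).
  by apply/tuple_uniqP/card_uniqP; rewrite size_tuple -cardsE.
have /(buildingP T)[g [K [gG KS _ /setP tE]]] := tX.
(* Inside [t], a vertex is determined by its type. *)
have typeE m u s : u \in <<J>>%g -> s \in J -> tnth t m = vert u s ->
    tnth t m = vertex S g s.
  move=> uJ sJ mE; have := tE (tnth t m); rewrite inE mem_tnth.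
  move=> /esym/imsetP[a aK mE']; rewrite mE'; congr vertex.
  apply: (vertex_type T gG (repr_G (JW uJ))); rewrite ?(subsetP JS _ sJ) ?(subsetP KS _ aK) //.
  by rewrite -mE' mE.
apply/eqP/negPn/negP=> jk.
have [k' kE'] : exists k', k = lift j k'.
  by case: (unliftP j k) jk => [k' ->|->]; [exists k'|rewrite eqxx].
have := jE (tnth t k); rewrite !inE {1}kE'.
have -> : tnth t (lift j k') = tnth (face t j) k' by rewrite tnth_mktuple.
rewrite mem_tnth => /esym/tnthP[m]; rewrite sigma_nth.
set s := tau _ => tk; have sJ : s \in J by apply: imset_f.
have := kE (vert w s); rewrite !inE.
have -> : vert w s \in sigma w by apply/tnthP; exists m; rewrite sigma_nth.
move=> /tnthP[n]; rewrite tnth_mktuple => /esym tn.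
have /t_inj/eqP : tnth t (lift k n) = tnth t k.
  by rewrite (typeE _ _ _ wJ sJ tn) (typeE _ _ _ vJ sJ tk).
by rewrite eq_sym (negPf (neq_lift _ _)).
Qed.

Lemma building_sparse_cochain :
  exists f : cochain R X i, [/\ f != 0, sparse f &
    forall z, coboundary z = 0 -> cochain_dot z f = 0].
Proof.
by exists sphere; split=> // z dz; rewrite sphere_dot sphere_cocycle.
Qed.

End ApartmentSphere.

Theorem theorem2p22 (R : realType) (gT : finGroupType) (G B N : {group gT})
    (S : {set coset_of (B :&: N)}) (l : nat)
    (hT : Tits_system G S) (hrank : #|S| = l.+1)
    (i : nat) (hi : (i < l)%N) :
  exists m : R,
    is_min_nonzero_eigenvalue (@laplacian R _ (building G B) i) m
    /\ m <= (l - i)%:R.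
Proof.
have [f [f0 sf fz]] := building_sparse_cochain R hT hrank hi.
exact: (sparse_min_nonzero_eigenvalue_le (building_subset hT)
  (building_chamber hT hrank) (building_dim hT hrank) f0 sf fz).
Qed.
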